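(* Let $R$ be a non-trivial associative ring. If $l.\mathrm{Ggldim}(R)<\infty$, then $(\mathcal{GP}(R),\mathcal{GP}(R)^{\perp})$ and $({}^{\perp}\mathcal{GI}(R),\mathcal{GI}(R))$ are complete hereditary cotorsion theories.
   Context: All modules are left unitary $R$-modules. An $R$-module $M$ is Gorenstein projective if there is an exact sequence of projective $R$-modules $\mathbf{P}:\cdots\to P_1\to P_0\to P^0\to P^1\to\cdots$ with $M\cong \mathrm{Im}(P_0\to P^0)$ such that $\mathrm{Hom}_R(-,Q)$ leaves $\mathbf{P}$ exact for every projective module $Q$. Gorenstein injective modules are defined dually: there is an exact sequence of injective modules $\mathbf{I}:\cdots\to I_1\to I_0\to I^0\to I^1\to\cdots$ with $M\cong\mathrm{Im}(I_0\to I^0)$ such that $\mathrm{Hom}_R(E,-)$ leaves $\mathbf{I}$ exact for every injective module $E$. $\mathcal{GP}(R)$ and $\mathcal{GI}(R)$ denote the classes of Gorenstein projective and Gorenstein injective modules. The Gorenstein projective dimension $\mathrm{Gpd}_R(M)$ is the least $n\ge 0$ such that there is an exact sequence $0\to G_n\to\cdots\to G_0\to M\to 0$ with all $G_i$ Gorenstein projective ($\infty$ if none exists); the Gorenstein injective dimension $\mathrm{Gid}_R(M)$ is defined dually by coresolutions. The left Gorenstein global dimension $l.\mathrm{Ggldim}(R)$ is the common value of $\sup\{\mathrm{Gpd}_R(M)\mid M \text{ an } R\text{-module}\}$ and $\sup\{\mathrm{Gid}_R(M)\mid M\text{ an }R\text{-module}\}$ (these are known to be equal). For a class $\mathfrak{X}$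 of modules, $\mathfrak{X}^{\perp}=\{M\mid \mathrm{Ext}^1_R(X,M)=0 \text{ for all } X\in\mathfrak{X}\}$ and ${}^{\perp}\mathfrak{X}=\{M\mid \mathrm{Ext}^1_R(M,X)=0\text{ for all }X\in\mathfrak{X}\}$. An $\mathfrak{X}$-precover of $M$ is a homomorphism $\varphi:X\to M$ with $X\in\mathfrak{X}$ such that $\mathrm{Hom}_R(X',X)\to\mathrm{Hom}_R(X',M)$ is surjective for every $X'\in\mathfrak{X}$; it is special if $\varphi$ is surjective and $\ker\varphi\in\mathfrak{X}^{\perp}$. An $\mathfrak{X}$-preenvelope of $M$ is a homomorphism $\varphi:M\to X$ with $X\in\mathfrak{X}$ such that $\mathrm{Hom}_R(X,X')\to\mathrm{Hom}_R(M,X')$ is surjective for every $X'\in\mathfrak{X}$; it is special if $\varphi$ is injective and $\mathrm{coker}\,\varphi\in{}^{\perp}\mathfrak{X}$. A pair $(\mathfrak{X},\mathfrak{Y})$ of classes of modules is a cotorsion theory if $\mathfrak{X}^{\perp}=\mathfrak{Y}$ and ${}^{\perp}\mathfrak{Y}=\mathfrak{X}$. It is complete if every module has a special $\mathfrak{Y}$-preenvelope and a special $\mathfrak{X}$-precover. It is hereditary if whenever $0\to L'\to L\to L''\to 0$ is exact with $L,L''\in\mathfrak{X}$, then $L'\in\mathfrak{X}$ (equivalently, whenever $0\to M'\to M\to M''\to 0$ is exact with $M',M\in\mathfrak{Y}$, then $M''\in\mathfrak{Y}$). *)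

(* Defs.v *)
From mathcomp Require Import all_boot all_order all_algebra.
From mathcomp Require Import boolp.

Set Implicit Arguments.
Unset Strict Implicit.
Unset Printing Implicit Defensive.

Import GRing.Theory.
Local Open Scope ring_scope.

Definition surjective_map (A B : Type) (f : A -> B) : Prop :=
  forall y, exists x, f x = y.

Section Modules.
Variable R : nzRingType.
Implicit Types M N : lmodType R.

Definition module_class := lmodType R -> Prop.

(* ker g = im f *)
Definition exact_at (A B C : lmodType R)
    (f : {linear A -> B}) (g : {linear B -> C}) : Prop :=
  forall b, g b = 0 <-> exists a, f a = b.

(* Exactness of Hom(C, Q) -> Hom(B, Q) -> Hom(A, Q) at Hom(B, Q). *)
Definition hom_to_exact_at (Q A B C : lmodType R)
    (f : {linear A -> B}) (g : {linear B -> C}) : Prop :=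
  forall h : {linear B -> Q},
    (forall a, h (f a) = 0) <->
    exists k : {linear C -> Q}, forall b, k (g b) = h b.

(* Exactness of Hom(E, A) -> Hom(E, B) -> Hom(E, C) at Hom(E, B). *)
Definition hom_from_exact_at (E A B C : lmodType R)
    (f : {linear A -> B}) (g : {linear B -> C}) : Prop :=
  forall h : {linear E -> B},
    (forall e, g (h e) = 0) <->
    exists k : {linear E -> A}, forall e, f (k e) = h e.

Definition short_exact (A B C : lmodType R)
    (f : {linear A -> B}) (g : {linear B -> C}) : Prop :=
  [/\ injective f, exact_at f g & surjective_map g].

Definition projective : module_class := fun P =>
  forall (A B : lmodType R) (g : {linear A -> B}) (f : {linear P -> B}),
    surjective_map g ->
    exists h : {linear P -> A}, forall x, g (h x) = f x.

Definition injective_module : module_class := fun E =>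
  forall (A B : lmodType R) (i : {linear A -> B}) (f : {linear A -> E}),
    injective i ->
    exists h : {linear B -> E}, forall x, h (i x) = f x.

(* Exact sequences ... -> X_1 -> X_0 -> M -> 0. *)
Record resolution M := Resolution {
  res_obj :> nat -> lmodType R;
  res_d : forall i, {linear res_obj i.+1 -> res_obj i};
  res_aug : {linear res_obj 0%N -> M};
  res_aug_surj : surjective_map res_aug;
  res_exact0 : exact_at (res_d 0%N) res_aug;
  res_exactS : forall i, exact_at (res_d i.+1) (res_d i)
}.

(* Exact sequences 0 -> M -> X^0 -> X^1 -> ... *)
Record coresolution M := Coresolution {
  cores_obj :> nat -> lmodType R;
  cores_d : forall i, {linear cores_obj i -> cores_obj i.+1};
  cores_aug : {linear M -> cores_obj 0%N};
  cores_aug_inj : injective cores_aug;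
  cores_exact0 : exact_at cores_aug (cores_d 0%N);
  cores_exactS : forall i, exact_at (cores_d i) (cores_d i.+1)
}.

(* Sequences ... -> X_1 -> X_0 -> X^0 -> X^1 -> ...; the lower half is
   [cpx_lo], the upper half [cpx_up], and [cpx_mid] is X_0 -> X^0. *)
Record sequence := Sequence {
  cpx_lo : nat -> lmodType R;
  cpx_up : nat -> lmodType R;
  cpx_dlo : forall i, {linear cpx_lo i.+1 -> cpx_lo i};
  cpx_mid : {linear cpx_lo 0%N -> cpx_up 0%N};
  cpx_dup : forall i, {linear cpx_up i -> cpx_up i.+1}
}.

Definition at_each_spot
    (E : forall A B C : lmodType R, {linear A -> B} -> {linear B -> C} -> Prop)
    (X : sequence) : Prop :=
  [/\ forall i, E _ _ _ (cpx_dlo X i.+1) (cpx_dlo X i),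
      E _ _ _ (cpx_dlo X 0%N) (cpx_mid X),
      E _ _ _ (cpx_mid X) (cpx_dup X 0%N)
    & forall i, E _ _ _ (cpx_dup X i) (cpx_dup X i.+1)].

Definition exact_sequence := at_each_spot exact_at.
Definition hom_to_exact (Q : lmodType R) := at_each_spot (@hom_to_exact_at Q).
Definition hom_from_exact (E : lmodType R) :=
  at_each_spot (@hom_from_exact_at E).

Definition all_terms_in (C : module_class) (X : sequence) : Prop :=
  forall i, C (cpx_lo X i) /\ C (cpx_up X i).

(* M is isomorphic to Im f; j is the isomorphism followed by the inclusion
   of Im f in B. *)
Definition iso_image M (A B : lmodType R) (f : {linear A -> B}) : Prop :=
  exists j : {linear M -> B}, injective j /\
    forall b, (exists m, j m = b) <-> (exists a, f a = b).

Definition GP : module_class := fun M =>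
  exists P : sequence,
    [/\ all_terms_in projective P, exact_sequence P,
        iso_image M (cpx_mid P)
      & forall Q, projective Q -> hom_to_exact Q P].

Definition GI : module_class := fun M =>
  exists I : sequence,
    [/\ all_terms_in injective_module I, exact_sequence I,
        iso_image M (cpx_mid I)
      & forall E, injective_module E -> hom_from_exact E I].

Definition zero_module M : Prop := forall x : M, x = 0.

(* 0 -> G_n -> ... -> G_0 -> M -> 0, extended by zero modules on the left *)
Definition has_GP_resolution M (n : nat) : Prop :=
  exists G : resolution M,
    (forall i, (i <= n)%N -> GP (G i)) /\
    (forall i, (n < i)%N -> zero_module (G i)).

Definition has_GI_coresolution M (n : nat) : Prop :=
  exists G : coresolution M,
    (forall i, (i <= n)%N -> GI (G i)) /\
    (forall i, (n < i)%N -> zero_module (G i)).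

(* Dimensions take values in [option nat], where [None] is infinity. *)
Definition le_dim (a b : option nat) : Prop :=
  match a, b with
  | _, None => True
  | None, Some _ => False
  | Some m, Some n => (m <= n)%N
  end.

Definition least (P : nat -> Prop) : option nat :=
  if pselect (exists n, `[< P n >]) is left exP then Some (ex_minn exP)
  else None.

Definition Gpd M : option nat := least (has_GP_resolution M).
Definition Gid M : option nat := least (has_GI_coresolution M).

Definition is_sup_dim (dim : lmodType R -> option nat) (d : option nat) :=
  (forall M, le_dim (dim M) d) /\
  (forall e, (forall M, le_dim (dim M) e) -> le_dim d e).

(* d is the common value of the suprema of Gpd and of Gid *)
Definition is_lGgldim (d : option nat) : Prop :=
  is_sup_dim Gpd d /\ is_sup_dim Gid d.

(* Ext^1(X, M) = H^1(Hom(P, M)) for a projective resolution P of X; up to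
   isomorphism this does not depend on P, and P exists because free modules
   are projective, so asking for all P is the same as asking for one. *)
Definition Ext1_eq0 (X M : lmodType R) : Prop :=
  forall P : resolution X, (forall i, projective (P i)) ->
    hom_to_exact_at M (res_d P 1%N) (res_d P 0%N).

Definition rperp (C : module_class) : module_class := fun M =>
  forall X, C X -> Ext1_eq0 X M.

Definition lperp (C : module_class) : module_class := fun M =>
  forall X, C X -> Ext1_eq0 M X.

Definition precover (C : module_class) (M X : lmodType R)
    (phi : {linear X -> M}) : Prop :=
  C X /\
  forall X' : lmodType R, C X' ->
    forall f : {linear X' -> M},
      exists g : {linear X' -> X}, forall x, phi (g x) = f x.

Definition preenvelope (C : module_class) (M X : lmodType R)
    (phi : {linear M -> X}) : Prop :=
  C X /\
  forall X' : lmodType R, C X' ->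
    forall f : {linear M -> X'},
      exists g : {linear X -> X'}, forall x, g (phi x) = f x.

(* The kernel K (below, the cokernel) is given up to isomorphism. *)
Definition special_precover (C : module_class) (M X : lmodType R)
    (phi : {linear X -> M}) : Prop :=
  precover C phi /\
  exists (K : lmodType R) (i : {linear K -> X}),
    short_exact i phi /\ rperp C K.

Definition special_preenvelope (C : module_class) (M X : lmodType R)
    (phi : {linear M -> X}) : Prop :=
  preenvelope C phi /\
  exists (K : lmodType R) (p : {linear X -> K}),
    short_exact phi p /\ lperp C K.

Definition cotorsion_theory (X Y : module_class) : Prop :=
  (forall M, rperp X M <-> Y M) /\ (forall M, lperp Y M <-> X M).

Definition complete (X Y : module_class) : Prop :=
  forall M,
    (exists (N : lmodType R) (phi : {linear M -> N}),
       special_preenvelope Y phi) /\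
    (exists (N : lmodType R) (phi : {linear N -> M}),
       special_precover X phi).

Definition hereditary (X : module_class) : Prop :=
  forall (L' L L'' : lmodType R) (f : {linear L' -> L}) (g : {linear L -> L''}),
    short_exact f g -> X L -> X L'' -> X L'.

Definition complete_hereditary_cotorsion_theory (X Y : module_class) : Prop :=
  [/\ cotorsion_theory X Y, complete X Y & hereditary X].

End Modules.

Arguments GP {R} M.
Arguments GI {R} M.

(* Main.v *)
(* Everything happens in an exact category with enough projectives and
   injectives, a self-dual notion, so the statement for GI is the one for GP
   in the opposite category. Let Y be the right perpendicular class of GP. It
   is closed under cokernels of monomorphisms and contains the injectives,
   hence the left perpendicular class of Y is hereditary, and it only remains
   to embed every M in some H in Y with cokernel in GP. By dimension
   shifting, finiteness of the Gorenstein global dimension bounds by some d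
   the projective dimension of injectives and the injective dimension of
   projectives. Comparing projective resolutions of the terms of an exact
   sequence 0 -> N -> I -> C -> 0 with I injective then embeds every d-th
   syzygy in a projective with cokernel a d-th syzygy, so d-th syzygies are
   in GP; the required embeddings descend from the d-th syzygy of M to M by
   pushouts. Finally GP is the left perpendicular class of Y, because an
   object of both Y and this class is projective. *)
From HB Require Import structures.
Require Import Defs.
From mathcomp Require Import all_boot all_order all_algebra.
From mathcomp Require Import generic_quotient boolp.

Set Implicit Arguments.
Unset Strict Implicit.
Unset Printing Implicit Defensive.

Import GRing.Theory.

(** * Gorenstein projectives in exact categories *)

(** Short exact sequences are primitive, with neither a zero object nor addition of morphisms. The
    axioms are stable under reversing arrows, so that [opposite] can be defined and every later
    lemma has a dual. *)
Record exact_category := ExactCategory {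
  obj :> Type;
  mor : obj -> obj -> Type;
  idm : forall A, mor A A;
  cmp : forall A B C, mor B C -> mor A B -> mor A C;
  cmpA : forall A B C D (h : mor C D) (g : mor B C) (f : mor A B),
    cmp h (cmp g f) = cmp (cmp h g) f;
  cmp1m : forall A B (f : mor A B), cmp (idm B) f = f;
  cmpm1 : forall A B (f : mor A B), cmp f (idm A) = f;
  ses : forall A B C, mor A B -> mor B C -> Prop;
  ses_fill_left : forall A B C A' B' C' (f : mor A B) (g : mor B C)
      (f' : mor A' B') (g' : mor B' C') (u : mor B B') (w : mor C C'),
    ses f g -> ses f' g' -> cmp g' u = cmp w g ->
    exists v, cmp f' v = cmp u f;
  ses_fill_right : forall A B C A' B' C' (f : mor A B) (g : mor B C)
      (f' : mor A' B') (g' : mor B' C') (v : mor A A') (u : mor B B'),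
    ses f g -> ses f' g' -> cmp f' v = cmp u f ->
    exists w, cmp w g = cmp g' u;
  (* [ses_lift] and [ses_extend]: in a morphism of short exact sequences, the
     left component extends over the middle term iff the right one lifts. *)
  ses_lift : forall A B C A' B' C' (f : mor A B) (g : mor B C)
      (f' : mor A' B') (g' : mor B' C')
      (v : mor A A') (u : mor B B') (w : mor C C'),
    ses f g -> ses f' g' -> cmp f' v = cmp u f -> cmp g' u = cmp w g ->
    (exists s, cmp s f = v) -> exists t, cmp g' t = w;
  ses_extend : forall A B C A' B' C' (f : mor A B) (g : mor B C)
      (f' : mor A' B') (g' : mor B' C')
      (v : mor A A') (u : mor B B') (w : mor C C'),
    ses f g -> ses f' g' -> cmp f' v = cmp u f -> cmp g' u = cmp w g ->
    (exists t, cmp g' t = w) -> exists s, cmp s f = v;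
  ses_flip : forall A B C (f : mor A B) (g : mor B C) (r : mor B A),
    ses f g -> cmp r f = idm A ->
    exists (s : mor C B) (r' : mor B A), ses s r';
  ses_pushout : forall A B C A' (f : mor A B) (g : mor B C) (h : mor A A'),
    ses f g -> exists B' (f' : mor A' B') (g' : mor B' C) (h' : mor B B'),
    [/\ ses f' g', cmp h' f = cmp f' h, cmp g' h' = g,
        forall D (k : mor A' D), ses h k -> exists k' : mor B' D, ses h' k'
      & forall D (k : mor D A), ses k h -> ses (cmp f k) h'];
  ses_pullback : forall A B C C' (f : mor A B) (g : mor B C) (h : mor C' C),
    ses f g -> exists B' (f' : mor A B') (g' : mor B' C') (h' : mor B' B),
    [/\ ses f' g', cmp h' f' = f, cmp g h' = cmp h g',
        forall D (k : mor D C'), ses k h -> exists k' : mor D B', ses k' h'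
      & forall D (k : mor C D), ses h k -> ses h' (cmp k g)]
}.

Arguments idm {e A}.
Local Notation "g \after f" := (cmp g f) (at level 40, left associativity).

Definition opposite (E : exact_category) : exact_category.
Proof.
refine (@ExactCategory E (fun A B => mor B A) (fun A => idm)
  (fun A B C g f => f \after g) _ _ _ (fun A B C f g => ses g f)
  _ _ _ _ _ _ _).
- by move=> *; rewrite cmpA.
- by move=> *; rewrite cmpm1.
- by move=> *; rewrite cmp1m.
- move=> A B C A' B' C' f g f' g' u w fg fg' e.
  by have [v vE] := ses_fill_right fg' fg (esym e); exists v.
- move=> A B C A' B' C' f g f' g' v u fg fg' e.
  by have [w wE] := ses_fill_left fg' fg (esym e); exists w.
- move=> A B C A' B' C' f g f' g' v u w fg fg' e1 e2.
  exact: (ses_extend fg' fg (esym e2) (esym e1)).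
- move=> A B C A' B' C' f g f' g' v u w fg fg' e1 e2.
  exact: (ses_lift fg' fg (esym e2) (esym e1)).
- move=> A B C f g r fg rf.
  (* Read in [E], [r] is a section of the epimorphism [f]; it is first turned into a retraction [s]
     of [g], to which [ses_flip] applies. *)
  have [|||s sg] := @ses_extend E _ _ _ _ _ _ g f g f idm idm idm fg fg.
  + by rewrite cmpm1 cmp1m.
  + by rewrite cmpm1 cmp1m.
  + by exists r.
  by have [s' [r' h]] := ses_flip fg sg; exists r', s'.
- move=> A B C A' f g h fg.
  have [B' [f' [g' [h' [h1 h2 h3 h4 h5]]]]] := ses_pullback h fg.
  by exists B', g', f', h'; split.
- move=> A B C C' f g h fg.
  have [B' [f' [g' [h' [h1 h2 h3 h4 h5]]]]] := ses_pushout h fg.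
  by exists B', g', f', h'; split.
Defined.

Definition proj (E : exact_category) (P : E) :=
  forall A B C (f : mor A B) (g : mor B C), ses f g ->
  forall h : mor P C, exists k : mor P B, g \after k = h.

Section Classes.
Variable E : exact_category.
Implicit Types A B C G H K L M N P Q X Z : E.

(** This is Ext^1(X, M) = 0, phrased without resolutions or Ext groups; [Ext1_eq0E] compares it with
    the definition by resolutions. *)
Definition Orth X M := forall A B (f : mor A B) (g : mor B X), ses f g ->
  forall h : mor A M, exists k : mor B M, k \after f = h.

Definition inj I := @proj (opposite E) I.

Definition perpL (Y : E -> Prop) X := forall M, Y M -> Orth X M.
Definition perpR (X : E -> Prop) M := forall G, X G -> Orth G M.

(* Gorenstein projectivity in coinductive form: [C] plays the role of the
   class of all cycles of a complete resolution. *)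
Definition GProj M := exists C : E -> Prop, C M /\ forall X, C X ->
  [/\ forall P, proj P -> Orth X P,
      exists P X' (f : mor X P) (g : mor P X'), [/\ ses f g, proj P & C X']
    & exists P X' (f : mor X' P) (g : mor P X), [/\ ses f g, proj P & C X']].

Definition enough_proj :=
  forall M, exists K P (f : mor K P) (g : mor P M), ses f g /\ proj P.

Lemma GProj_orth M P : GProj M -> proj P -> Orth M P.
Proof. by move=> [C [CM CP]] pP; case: (CP _ CM) => h _ _; apply: h. Qed.

Lemma GProj_right M : GProj M ->
  exists P X (f : mor M P) (g : mor P X), [/\ ses f g, proj P & GProj X].
Proof.
move=> [C [CM CP]]; have [_ [P [X [f [g [fg pP CX]]]]] _] := CP _ CM.
by exists P, X, f, g; split=> //; exists C.
Qed.

Lemma GProj_left M : GProj M ->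
  exists P X (f : mor X P) (g : mor P M), [/\ ses f g, proj P & GProj X].
Proof.
move=> [C [CM CP]]; have [_ _ [P [X [f [g [fg pP CX]]]]]] := CP _ CM.
by exists P, X, f, g; split=> //; exists C.
Qed.
End Classes.

(** Pulling back along [h] gives an extension of [X] by [M]. Its retraction yields a section, and
    the section composed with [h'] lifts [h]. *)
Lemma orth_op (E : exact_category) (X M : E) :
  Orth X M -> @Orth (opposite E) M X.
Proof.
move=> XM A B f g /= fg h.
have [B' [f' [g' [h' [fg' hf gh _ _]]]]] := ses_pullback h fg.
have [r rf] := XM _ _ _ _ fg' idm.
have [|||t tE] := @ses_lift E _ _ _ _ _ _ f' g' f' g' idm idm idm fg' fg'.
- by rewrite cmpm1 cmp1m.
- by rewrite cmpm1 cmp1m.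
- by exists r.
by exists (h' \after t); rewrite cmpA gh -cmpA tE cmpm1.
Qed.

Lemma orth_lift (E : exact_category) (X M B C : E) (f : mor M B) (g : mor B C) :
  Orth X M -> ses f g -> forall h : mor X C, exists k : mor X B, g \after k = h.
Proof. by move=> /orth_op XM fg h; apply: (XM _ _ _ _ fg). Qed.

Lemma orth_opK (E : exact_category) (X M : E) :
  @Orth (opposite E) M X -> Orth X M.
Proof. by move=> h; apply: (orth_op h). Qed.

(** * Exactness properties of Ext^1 and dimension shifting *)

Section OrthLemmas.
Variable E : exact_category.
Implicit Types A B C G H K L M N P Q X Z : E.

(** Pushing out along [h] reduces the extension of [h] to a retraction of an extension of [X] by
    [M]. *)
Lemma orth_split X M :
  (forall B (f : mor M B) (g : mor B X),
    ses f g -> exists r, r \after f = idm) ->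
  Orth X M.
Proof.
move=> spl A B f g fg h.
have [B' [f' [g' [h' [fg' hf gh _ _]]]]] := ses_pushout h fg.
have [r rf] := spl _ _ _ fg'.
by exists (r \after h'); rewrite -cmpA hf cmpA rf cmp1m.
Qed.

Lemma orth_proj P M : proj P -> Orth P M.
Proof.
by move=> pP; apply: orth_opK => A B f g fg h; apply: (pP _ _ _ _ _ fg).
Qed.

Lemma orth_inj X I : inj I -> Orth X I.
Proof. by move=> iI A B f g fg h; apply: (iI _ _ _ _ _ fg). Qed.

Lemma proj_orth P : (forall M, Orth P M) -> proj P.
Proof. by move=> oP A B C f g fg h; apply: (orth_lift (oP A) fg). Qed.

(** When Ext^1(P, M) = 0, Ext^1(X, M) is the cokernel of Hom(P, M) -> Hom(K, M), so a single
    presentation of [X] decides. *)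
Lemma orth_test K P X M (f : mor K P) (g : mor P X) : ses f g -> Orth P M ->
  (forall h : mor K M, exists k : mor P M, k \after f = h) -> Orth X M.
Proof.
move=> fg PM ext; apply: orth_split => B i p ip.
have [u pu] := orth_lift PM ip g.
have [|v iv] := ses_fill_left (u := u) (w := idm) fg ip.
  by rewrite pu cmp1m.
(* Since [v] extends over [P], the identity of [X] lifts to a section [t] of [p], which then gives
   the retraction of [i]. *)
have [||t tE] := ses_lift (w := idm) fg ip iv; first by rewrite pu cmp1m.
  exact: ext.
apply: (ses_extend (u := idm) (w := idm) ip ip).
- by rewrite cmpm1 cmp1m.
- by rewrite cmpm1 cmp1m.
- by exists t.
Qed.

(** The extension restricted to [L'] splits, and its retraction extends from [B'] to [B] because the
    cokernel of [h'] is [L]. *)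
Lemma orth_ext X M L L' (f : mor L' X) (g : mor X L) : ses f g ->
  Orth L' M -> Orth L M -> Orth X M.
Proof.
move=> fg L'M LM; apply: orth_split => B i p ip.
have [B' [i' [p' [h' [ip' hi ph _ h's]]]]] := ses_pullback f ip.
have [r' r'E] := L'M _ _ _ _ ip' idm.
have [r rE] := LM _ _ _ _ (h's _ _ fg) r'.
by exists r; rewrite -hi cmpA rE.
Qed.

End OrthLemmas.

Lemma orth_test_op (E : exact_category) (M I C X : E)
    (f : mor M I) (g : mor I C) : ses f g -> Orth X I ->
  (forall h : mor X C, exists k : mor X I, g \after k = h) -> Orth X M.
Proof.
move=> fg /orth_op XI lift; apply: orth_opK.
exact: (@orth_test (opposite E) _ _ _ _ g f).
Qed.

(** This is the exact piece Ext^1(Q, C) -> Ext^2(Q, M) -> Ext^2(Q, G), read with Ext^2(Q, -) =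
    Ext^1(J, -). *)
Lemma orth_shift (E : exact_category) (J P Q M G C : E)
    (j : mor J P) (q : mor P Q) (f : mor M G) (g : mor G C) :
  ses j q -> proj P -> ses f g -> Orth J G -> Orth Q C -> Orth J M.
Proof.
move=> jq pP fg JG QC; apply: (orth_test_op fg JG) => h.
have [k kE] := QC _ _ _ _ jq h; have [l lE] := pP _ _ _ _ _ fg k.
by exists (l \after j); rewrite cmpA lE.
Qed.

(** * The right perpendicular class of the Gorenstein projectives *)

Section GorensteinPerp.
Variable E : exact_category.
Implicit Types A B C G H K L M N P Q X Z : E.

Local Notation Y := (perpR (@GProj E)).

Lemma perpR_proj P : proj P -> Y P.
Proof. by move=> pP G gG; apply: GProj_orth. Qed.

(** Ext^1(G, C) lies between Ext^1(G, B) and Ext^2(G, A) = Ext^1(G1, A), where the syzygy [G1] of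
    [G] is again Gorenstein projective. *)
Lemma perpR_coker A B C (f : mor A B) (g : mor B C) :
  ses f g -> Y A -> Y B -> Y C.
Proof.
move=> fg YA YB G gG; have [P [G1 [i [p [ip pP gG1]]]]] := GProj_left gG.
apply: (orth_test ip (orth_proj pP)) => h.
have [k kE] := orth_lift (YA _ gG1) fg h.
have [l lE] := YB _ gG _ _ _ _ ip k.
by exists (g \after l); rewrite -cmpA lE.
Qed.

(** Each Gorenstein projective [G] is a syzygy of another one, [G'], so Ext^1(G, K) is shifted to
    Ext^1(G', H). *)
Lemma perpR_ker K P H (f : mor K P) (g : mor P H) :
  ses f g -> proj P -> Y H -> Y K.
Proof.
move=> fg pP YH G gG; have [P' [G' [i [p [ip pP' gG']]]]] := GProj_right gG.
exact: (orth_shift ip pP' fg (GProj_orth gG pP) (YH _ gG')).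
Qed.

(** The kernel of a projective presentation of [H] lies in [Y], so the presentation splits and [H]
    is a retract of a projective. *)
Lemma perpLR_proj H : enough_proj E -> Y H -> perpL Y H -> proj H.
Proof.
move=> enough YH H'; have [K [P [f [g [fg pP]]]]] := enough H.
have [s sE] := orth_lift (H' _ (perpR_ker fg pP YH)) fg idm.
move=> A B C i p ip h; have [k kE] := pP _ _ _ _ _ ip (h \after g).
by exists (k \after s); rewrite cmpA kE -cmpA sE cmpm1.
Qed.

(** Embed [M] in an injective [I]; the cokernel [C] stays in [Y]. A map from [L'] to [C] extends
    over [L], lifts to [I] there, and is restricted back to [L']. *)
Lemma perpL_hereditary L' L L'' (f : mor L' L) (g : mor L L'') :
  enough_proj (opposite E) ->
  ses f g -> perpL Y L -> perpL Y L'' -> perpL Y L'.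
Proof.
move=> enough fg XL XL'' M YM; have [C [I [p [i [/= ip iI]]]]] := enough M.
have YI : Y I by move=> G _; apply: (orth_inj iI).
apply: (orth_test_op ip); first exact: orth_inj.
move=> h; have [k kE] := XL'' _ (perpR_coker ip YM YI) _ _ _ _ fg h.
have [l lE] := orth_lift (XL _ YM) ip k.
by exists (l \after f); rewrite cmpA lE.
Qed.

(** The cokernel is asked to be in [GProj], not merely in [perpL Y]: the equality of these classes
    is itself deduced from such embeddings. *)
Definition preenv M := exists H G (f : mor M H) (g : mor H G),
  [/\ ses f g, Y H & GProj G].

Definition precov M := exists H G (f : mor H G) (g : mor G M),
  [/\ ses f g, Y H & perpL Y G].

Section Step.
Variables (K P N : E) (i : mor K P) (p : mor P N).
Hypotheses (ip : ses i p) (pP : proj P) (preK : preenv K).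

(* Salce's pushout: [Z] is an extension of [G] by [P] and maps onto [N] with
   kernel [H]. *)
Lemma precov_step : precov N.
Proof.
have [H [G [f [g [fg YH gG]]]]] := preK.
have [Z [p' [g' [i' [pg _ _ Zs _]]]]] := ses_pushout i fg.
have [k ik] := Zs _ _ ip; exists H, Z, i', k; split=> // M YM.
by apply: (orth_ext pg); [apply: orth_proj | apply: YM].
Qed.

(* As [Orth G P], the pushout [Z] is the sum of [P] and [G], so that embedding
   [G] in a projective [Q] embeds [Z] in a projective [W]. *)
Lemma preenv_step : preenv N.
Proof.
have [H [G [f [g [fg YH gG]]]]] := preK.
have [Z [p' [g' [i' [pg _ _ Zs _]]]]] := ses_pushout i fg.
have [k ik] := Zs _ _ ip.
have [r rp] := GProj_orth gG pP pg idm.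
have [s [r' sr]] := ses_flip pg rp.
have [Q [G' [u [v [uv pQ gG']]]]] := GProj_right gG.
have [W [u' [v' [h' [uv' _ _ Ws _]]]]] := ses_pushout u sr.
have [w hw] := Ws _ _ uv.
(* Dividing [Z] and [W] by [H] embeds [N] in [V] with cokernel still [G']; [V] is in [Y] as the
   cokernel of a map from [H] to the projective [W]. *)
have [V [f' [g1 [k' [fg' _ _ _ Vs]]]]] := ses_pushout k hw.
exists V, G', f', g1; split=> //.
apply: (perpR_coker (Vs _ _ ik) YH); apply: perpR_proj; apply: proj_orth => M.
by apply: (orth_ext uv'); apply: orth_proj.
Qed.
End Step.

Definition Omega (D : E -> Prop) K := exists P N (f : mor K P) (g : mor P N),
  [/\ ses f g, proj P & D N].

(** A predicate, not a function: any projectives may be used, so that projective summands never have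
    to be cancelled. *)
Fixpoint syzygy k : E -> Prop :=
  if k is k'.+1 then Omega (syzygy k') else fun _ => True.

(** A syzygy of order [k.+1] of an object is one of order [k] of the first syzygy of that object. *)
Lemma syzygyW k M : syzygy k.+1 M -> syzygy k M.
Proof.
elim: k M => // k IH M [P [N [f [g [fg pP sN]]]]].
by exists P, N, f, g; split=> //; apply: IH.
Qed.

Lemma preenv_syzygy k : (forall M, syzygy k M -> preenv M) ->
  enough_proj E -> forall M, preenv M.
Proof.
move=> + enough; elim: k => [|k IH] pre M; first exact: pre.
apply: IH => {}M sM; have [K [P [f [g [fg pP]]]]] := enough M.
by apply: (preenv_step fg pP); apply: pre; exists P, M, f, g.
Qed.

End GorensteinPerp.

(** * Gorenstein dimension and embeddings of syzygies *)

Section GorensteinDimension.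
Variable E : exact_category.
Implicit Types A B C G H J K L M N P Q X Z : E.

Local Notation GInj := (@GProj (opposite E)).

(* Gorenstein injective dimension at most [k]; in the opposite category,
   Gorenstein projective dimension at most [k]. *)
Fixpoint gid_le k M : Prop :=
  GInj M \/
  if k is k'.+1 then exists G C (f : mor M G) (g : mor G C),
    [/\ ses f g, GInj G & gid_le k' C]
  else False.

Lemma gid_leW j k M : j <= k -> gid_le j M -> gid_le k M.
Proof.
elim: j k M => [|j IH] [|k] M // jk [gM|]; try by left.
move=> [G [C [f [g [fg gG gC]]]]]; right; exists G, C, f, g; split=> //.
exact: IH gC.
Qed.

(** A graded approximation to projectivity: injectives satisfy it for 0, each syzygy raises the
    index by one, and for [d] it means projective once every object has [gid_le d]. *)
Definition orth_gid k X := forall M, gid_le k M -> Orth X M.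

Lemma orth_gid_inj I : inj I -> orth_gid 0 I.
Proof. by move=> iI M [gM|//]; apply: orth_opK; apply: (GProj_orth gM). Qed.

Lemma orth_gidS k J P Q (j : mor J P) (q : mor P Q) :
  ses j q -> proj P -> orth_gid k Q -> orth_gid k.+1 J.
Proof.
move=> jq pP oQ.
(* The Gorenstein injective case comes first, since the general shift needs Ext^1(J, G) = 0. *)
have JG M : GInj M -> Orth J M.
  move=> gM; have [I [M' [p [i [/= ip iI gM']]]]] := GProj_left gM.
  apply: (orth_shift jq pP ip); first exact: orth_inj.
  by apply: oQ; apply: (@gid_leW 0) => //; left.
move=> M [/JG//|[G [C [f [g [fg gG gC]]]]]].
exact: (orth_shift jq pP fg (JG _ gG) (oQ _ gC)).
Qed.

(* Horseshoe lemma: [N] embeds in [Q] with cokernel [N'], and this lifts to the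
   syzygies up to a projective summand of the middle term. *)
Lemma syzygy_embed k S :
  enough_proj E -> enough_proj (opposite E) -> syzygy k S ->
  exists Z L (f : mor S Z) (g : mor Z L),
    [/\ ses f g, orth_gid k Z & syzygy k L].
Proof.
move=> enP enI; elim: k S => [|k IH] S.
  move=> _; have [C [I [p [i [/= ip iI]]]]] := enI S.
  by exists I, C, i, p; split=> //; apply: orth_gid_inj.
move=> [P [N [s1 [s2 [ss pP /IH[Q [N' [n1 [n2 [nn oQ sN']]]]]]]]]].
have [J [P1 [j1 [j2 [jj pP1]]]]] := enP Q.
(* [L] is the kernel of [P1 -> N'], hence a syzygy of order [k.+1]; it maps onto [N] with kernel
   [J]. *)
have [L [l1 [l2 [l3 [ll _ _ _ Ls]]]]] := ses_pullback n1 jj.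
(* The pullback [Z] of [P] and [L] over [N] has kernel [J] over [P] and kernel [S] over [L]. *)
have [Z [z1 [z2 [z3 [zz _ _ Zs _]]]]] := ses_pullback s2 ll.
have [s sz] := Zs _ _ ss.
exists Z, L, s, z3; split=> //.
- move=> M gM; apply: (orth_ext zz); last exact: orth_proj.
  exact: (orth_gidS jj pP1 oQ).
- by exists P1, N', l3, (n2 \after j2); split=> //; apply: Ls.
Qed.
End GorensteinDimension.

Lemma GProj_opK (E : exact_category) (M : E) :
  @GProj (opposite (opposite E)) M <-> GProj M.
Proof. by []. Qed.

Record finite_Gorenstein_dimension (E : exact_category) (d : nat) : Prop := {
  fgd_enough_proj : enough_proj E;
  fgd_enough_inj : enough_proj (opposite E);
  fgd_gid : forall M : E, gid_le d M;
  fgd_gpd : forall M : opposite E, gid_le d M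
}.

(* Proved for a variable [E], for which [opposite (opposite E)] is compared with
   [E] at once; for a concrete category this conversion is very slow. *)
Lemma finite_Gorenstein_dimension_op (E : exact_category) d :
  finite_Gorenstein_dimension E d ->
  finite_Gorenstein_dimension (opposite E) d.
Proof. by case=> enP enI gid gpd; split. Qed.

(** * The cotorsion pair in finite Gorenstein dimension *)

Section FiniteDimension.
Variable E : exact_category.
Implicit Types A B C G H J K L M N P Q X Z : E.
Variable d : nat.
Hypothesis fin : finite_Gorenstein_dimension E d.
Let enP := fgd_enough_proj fin.
Let enI := fgd_enough_inj fin.

Local Notation Y := (perpR (@GProj E)).

(** Shifting trades a syzygy [S] for an object one step lower and [M] for a cosyzygy, until the
    bound [d] on all Gorenstein projective dimensions applies. At [k = d] it makes d-th syzygies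
    orthogonal to projectives. *)
Lemma orth_syzygy k S M : k <= d -> syzygy k S ->
  @orth_gid (opposite E) (d - k) M -> Orth S M.
Proof.
elim: k S M => [|k IH] S M kd.
  by rewrite subn0 => _ oM; apply: orth_opK; apply: oM; apply: (fgd_gpd fin).
move=> [P [N [f [g [fg pP sN]]]]] oM.
have [C [I [p [i [/= ip iI]]]]] := enI M.
apply: (orth_shift fg pP ip); first exact: orth_inj.
apply: IH => //; first exact: ltnW.
rewrite subnS in oM.
(* Here [k < d], so the truncated predecessor is a genuine one. *)
have -> : d - k = (d - k).-1.+1 by rewrite prednK // subn_gt0.
exact: (@orth_gidS (opposite E) _ _ _ _ p i).
Qed.

(** The d-th syzygies themselves form the class of cycles required by [GProj]. *)
Lemma syzygy_GProj (S : E) : syzygy d S -> GProj S.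
Proof.
move=> sS; exists (syzygy d); split=> // X sX; split.
- move=> P pP; apply: (orth_syzygy _ sX) => //; rewrite subnn.
  exact: (@orth_gid_inj (opposite E)).
- have [Z [L [f [g [fg oZ sL]]]]] := syzygy_embed enP enI sX.
  (* [Z] is orthogonal to all objects with [gid_le d], that is, to all objects. *)
  exists Z, L, f, g; split=> //; apply: proj_orth => M.
  exact/oZ/(fgd_gid fin).
- have [K [P [f [g [fg pP]]]]] := enP X.
  by exists P, K, f, g; split=> //; apply: syzygyW; exists P, X, f, g.
Qed.

Lemma preenv_all M : preenv M.
Proof.
apply: (@preenv_syzygy E d) => // {}M /syzygy_GProj /GProj_right.
move=> [P [X [f [g [fg pP gX]]]]].
by exists P, X, f, g; split=> //; apply: perpR_proj.
Qed.

Lemma GProj_perpL M : GProj M -> perpL Y M.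
Proof. by move=> gM X; apply. Qed.

(** The class of cycles is [perpL Y] itself, whose stability under syzygies is heredity. *)
Lemma perpL_GProj M : perpL Y M -> GProj M.
Proof.
move=> XM; exists (perpL Y); split=> // {M XM} X XX; split.
- by move=> P pP; apply: XX; apply: perpR_proj.
- have [H [G [f [g [fg YH /GProj_perpL XG]]]]] := preenv_all X.
  (* [H] is in [Y], and also in [perpL Y] as an extension of objects of that class; hence it is
     projective. *)
  exists H, G, f, g; split=> //; apply: perpLR_proj => // M YM.
  by apply: (orth_ext fg); [apply: XX | apply: XG].
- have [K [P [f [g [fg pP]]]]] := enP X.
  exists P, K, f, g; split=> //; apply: (perpL_hereditary enI fg) => // M _.
  exact: orth_proj.
Qed.

Lemma precov_all M : exists H G (f : mor H G) (g : mor G M),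
  [/\ ses f g, Y H & GProj G].
Proof.
have [K [P [f [g [fg pP]]]]] := enP M.
have [H [G [i [p [ip YH XG]]]]] := precov_step fg pP (preenv_all K).
by exists H, G, i, p; split=> //; apply: perpL_GProj.
Qed.
End FiniteDimension.

Local Open Scope ring_scope.

(** * The exact category of modules *)

Section LinearMaps.
Variable R : nzRingType.
Implicit Types A B C D : lmodType R.

(** The axioms of [exact_category] use equality of morphisms. Function extensionality identifies the
    maps and proof irrelevance the linearity proofs. *)
Lemma linear_ext A B (f g : {linear A -> B}) : f =1 g -> f = g.
Proof.
case: f g => f [[F1] [F2]] [g [[G1] [G2]]] /= /funext fg.
move: F1 F2 G1 G2; rewrite fg => F1 F2 G1 G2.
by rewrite (Prop_irrelevance F1 G1) (Prop_irrelevance F2 G2).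
Qed.

Lemma linear_of A B (s : A -> B) :
  linear s -> exists l : {linear A -> B}, l =1 s.
Proof.
move=> Hs.
pose l : {linear A -> B} := HB.pack s (GRing.isLinear.Build R A B *:%R s Hs).
by exists l.
Qed.

(** * Submodules and quotient modules *)

Section Submodule.
Local Open Scope quotient_scope.
Variables (V : lmodType R) (S : V -> bool).
Hypothesis S_closed : submod_closed S.
Definition zmod_closed_pred : zmodClosed V :=
  HB.pack S (GRing.isZmodClosed.Build V S (GRing.submod_closedB S_closed)).
Definition submod_closed_pred : submodClosed V :=
  HB.pack S (GRing.isSubmodClosed.Build R V S S_closed).
Record submodule_type :=
  SubmoduleType { sm_val :> V; _ : sm_val \in submod_closed_pred }.
HB.instance Definition _ := [isSub for sm_val].
HB.instance Definition _ := [Choice of submodule_type by <:].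
HB.instance Definition _ := [SubChoice_isSubLmodule of submodule_type by <:].

Lemma submodule_exists : exists (K : lmodType R) (i : {linear K -> V}),
  injective i /\ forall x, x \in S <-> exists k, i k = x.
Proof.
exists submodule_type, (\val : {linear submodule_type -> V}).
split; first exact: val_inj.
move=> x; split; first by move=> xS; exists (SubmoduleType xS).
by case=> -[k kS] <-.
Qed.

Local Notation Q := (Quotient.quot zmod_closed_pred).

Definition quotient_scale (a : R) (x : Q) : Q := \pi_Q (a *: repr x).

Lemma quotient_piE (x y : V) : (\pi_Q x = \pi_Q y) <-> x - y \in S.
Proof.
split; first by move/eqP; rewrite -Quotient.idealrBE.
by move=> h; apply/eqP; rewrite -Quotient.idealrBE.
Qed.

Lemma quotient_scale_pi a (x : V) : quotient_scale a (\pi_Q x) = \pi_Q (a *: x).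
Proof.
apply/quotient_piE; rewrite -scalerBr.
apply: (rpredZ a (s:=submod_closed_pred)).
by apply/quotient_piE; rewrite reprK.
Qed.

Lemma quotient_surj (y : Q) : exists x, \pi_Q x = y.
Proof. by exists (repr y); rewrite reprK. Qed.

Lemma quotient_scaleA a b v :
  quotient_scale a (quotient_scale b v) = quotient_scale (a * b) v.
Proof.
by have [x <-] := quotient_surj v; rewrite !quotient_scale_pi scalerA.
Qed.

Lemma quotient_scale1 : left_id 1 quotient_scale.
Proof.
by move=> v; have [x <-] := quotient_surj v; rewrite quotient_scale_pi scale1r.
Qed.

Lemma quotient_scaleDr : right_distributive quotient_scale +%R.
Proof.
move=> a u v; have [x <-] := quotient_surj u; have [y <-] := quotient_surj v.
by rewrite -raddfD !quotient_scale_pi -raddfD scalerDr.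
Qed.

Lemma quotient_scaleDl v : {morph quotient_scale^~ v : a b / a + b}.
Proof.
move=> a b; have [x <-] := quotient_surj v.
by rewrite !quotient_scale_pi -raddfD scalerDl.
Qed.

HB.instance Definition _ := GRing.Zmodule_isLmodule.Build R Q
  quotient_scaleA quotient_scale1 quotient_scaleDr quotient_scaleDl.

Lemma quotient_exists : exists (C : lmodType R) (p : {linear V -> C}),
  surjective_map p /\ forall x, x \in S <-> p x = 0.
Proof.
have [|l Hl] := @linear_of V Q \pi_Q.
  move=> a x y; rewrite raddfD; congr (_ + _).
  exact: (esym (quotient_scale_pi a x)).
exists Q, l; split.
  by move=> y; have [x <-] := quotient_surj y; exists x.
move=> x; have := quotient_piE x 0; rewrite subr0 raddf0 Hl.
by move=> [h1 h2]; split.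
Qed.
End Submodule.

End LinearMaps.

(** * Kernels, cokernels, pushouts and pullbacks of modules *)

Section ModuleDiagrams.
Variable R : nzRingType.
Implicit Types A B C D K P Q X : lmodType R.

Lemma kernel_exists A B (f : {linear A -> B}) :
  exists (K : lmodType R) (i : {linear K -> A}), injective i /\ exact_at i f.
Proof.
have cl : submod_closed (fun x => f x == 0).
  split=> [|a x y]; rewrite -!topredE /= ?linear0 ?linearP // => /eqP-> /eqP->.
  by rewrite scaler0 addr0.
have [K [i [iI iE]]] := submodule_exists cl.
exists K, i; split=> // x; rewrite -iE -topredE /=.
by split=> /eqP.
Qed.

Lemma cokernel_exists A B (f : {linear A -> B}) :
  exists (C : lmodType R) (p : {linear B -> C}),
    surjective_map p /\ exact_at f p.
Proof.
have cl : submod_closed (fun y => `[< exists x, f x = y >]).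
  split=> [|a x y]; rewrite -!topredE /=.
    by apply/asboolP; exists 0; rewrite linear0.
  move=> /asboolP[x' <-] /asboolP[y' <-]; apply/asboolP.
  by exists (a *: x' + y'); rewrite linearP.
have [C [p [pS pE]]] := quotient_exists cl.
exists C, p; split=> // y; rewrite -pE -topredE /=.
by split=> /asboolP.
Qed.

Lemma factor_surj A B C (g : {linear A -> B}) (u : {linear A -> C}) :
  surjective_map g -> (forall a, g a = 0 -> u a = 0) ->
  exists v : {linear B -> C}, forall a, v (g a) = u a.
Proof.
move=> gS gu; have [s sE] := choice gS.
have us x y : g x = g y -> u x = u y.
  move=> e; apply/eqP; rewrite -subr_eq0 -linearB; apply/eqP/gu.
  by rewrite linearB e subrr.
have [|v vE] := @linear_of R B C (u \o s).
  move=> a x y /=; rewrite -linearP; apply: us.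
  by rewrite linearP !sE.
by exists v => a; rewrite vE; apply: us; rewrite sE.
Qed.

Lemma factor_inj A B C (f : {linear A -> B}) (u : {linear C -> B}) :
  injective f -> (forall c, exists a, f a = u c) ->
  exists v : {linear C -> A}, forall c, f (v c) = u c.
Proof.
move=> fI /choice[s sE].
have [|v vE] := @linear_of R C A s.
  by move=> a x y; apply: fI; rewrite linearP !sE linearP.
by exists v => c; rewrite vE.
Qed.

Lemma short_exact_ker A B (g : {linear A -> B}) : surjective_map g ->
  exists (K : lmodType R) (i : {linear K -> A}), short_exact i g.
Proof. by move=> gS; have [K [i [iI iE]]] := kernel_exists g; exists K, i. Qed.

Lemma short_exact_coker A B (f : {linear A -> B}) : injective f ->
  exists (C : lmodType R) (p : {linear B -> C}), short_exact f p.
Proof.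
by move=> fI; have [C [p [pS pE]]] := cokernel_exists f; exists C, p.
Qed.

Lemma short_exact0 A B C (f : {linear A -> B}) (g : {linear B -> C}) x :
  exact_at f g -> g (f x) = 0.
Proof. by move=> e; apply/e; exists x. Qed.

Section Morphisms.
Variables A B C A' B' C' : lmodType R.
Variables (f : {linear A -> B}) (g : {linear B -> C}).
Variables (f' : {linear A' -> B'}) (g' : {linear B' -> C'}).
Variables (v : {linear A -> A'}) (u : {linear B -> B'}) (w : {linear C -> C'}).
Hypotheses (fg : short_exact f g) (fg' : short_exact f' g').

Lemma short_exact_fill_left : (forall b, g' (u b) = w (g b)) ->
  exists v0 : {linear A -> A'}, forall a, f' (v0 a) = u (f a).
Proof.
have [_ e _] := fg; have [fI' e' _] := fg' => gu.
apply: (factor_inj (u := u \o f)) => //= a.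
by apply/e'; rewrite gu (short_exact0 _ e) linear0.
Qed.

Lemma short_exact_fill_right : (forall a, f' (v a) = u (f a)) ->
  exists w0 : {linear C -> C'}, forall b, w0 (g b) = g' (u b).
Proof.
have [_ e gS] := fg; have [_ e' _] := fg' => fu.
apply: (factor_surj (u := g' \o u)) => //= b /e[a <-].
by rewrite -fu (short_exact0 _ e').
Qed.

Hypotheses (fu : forall a, f' (v a) = u (f a)).
Hypothesis (gu : forall b, g' (u b) = w (g b)).

(** The difference [u - f' s] kills the image of [f], so it factors through [g] as [t]. *)
Lemma short_exact_homotopy_lift (s : {linear B -> A'}) :
  (forall a, s (f a) = v a) ->
  exists t : {linear C -> B'}, forall c, g' (t c) = w c.
Proof.
have [_ e gS] := fg; have [_ e' _] := fg' => sf.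
have [|t tE] := @factor_surj _ _ _ g (u \- (f' \o s)) gS.
  by move=> b /e[a <-] /=; rewrite sf fu subrr.
exists t => c; have [b <-] := gS c.
by rewrite tE /= linearB gu (short_exact0 _ e') subr0.
Qed.

(** Dually, [u - t g] has values in the kernel of [g'], so it factors through [f'] as [s]. *)
Lemma short_exact_homotopy_extend (t : {linear C -> B'}) :
  (forall c, g' (t c) = w c) ->
  exists s : {linear B -> A'}, forall a, s (f a) = v a.
Proof.
have [_ e _] := fg; have [fI' e' _] := fg' => gt.
have [|s sE] := @factor_inj _ _ _ f' (u \- (t \o g)) fI'.
  by move=> b; apply/e'; rewrite /= linearB gu gt subrr.
exists s => a; apply: fI'.
by rewrite sE /= (short_exact0 _ e) linear0 subr0 fu.
Qed.
End Morphisms.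

(** The idempotent [1 - f r] factors through [g] as a section [s] whose image is the kernel of
    [r]. *)
Lemma short_exact_flip A B C (f : {linear A -> B}) (g : {linear B -> C})
    (r : {linear B -> A}) : short_exact f g -> (forall a, r (f a) = a) ->
  exists s : {linear C -> B}, short_exact s r.
Proof.
move=> [fI e gS] rf.
have [|s sE] := @factor_surj _ _ _ g (idfun \- (f \o r)) gS.
  by move=> b /e[a <-] /=; rewrite rf subrr.
have gs c : g (s c) = c.
  by have [b <-] := gS c; rewrite sE /= linearB (short_exact0 _ e) subr0.
exists s; split.
- by move=> x y /(congr1 g); rewrite !gs.
- move=> b; split=> [rb|[c <-]].
    by exists (g b); rewrite sE /= rb linear0 subr0.
  by have [b' <-] := gS c; rewrite sE /= linearB rf subrr.
- by move=> a; exists (f a).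
Qed.

(** The pushout is the quotient of [A' * B] by the image of [a |-> (h a, - f a)]. *)
Lemma pushout_exists A B A' (f : {linear A -> B}) (h : {linear A -> A'}) :
  exists (B' : lmodType R) (f' : {linear A' -> B'}) (h' : {linear B -> B'}),
  [/\ forall y, exists x b, y = f' x + h' b,
      forall x b, f' x + h' b = 0 <-> exists a, x = h a /\ b = - f a
    & forall D (k : {linear A' -> D}) (l : {linear B -> D}),
      (forall a, k (h a) = l (f a)) ->
      exists m : {linear B' -> D},
        (forall x, m (f' x) = k x) /\ (forall b, m (h' b) = l b)].
Proof.
have [|d dE] := @linear_of R A (A' * B)%type (fun a => (h a, - f a)).
  by move=> a x y; rewrite !linearP.
have [|i1 i1E] := @linear_of R A' (A' * B)%type (fun a => (a, 0)).
  move=> a x y; congr pair; by rewrite /= scaler0 addr0.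
have [|i2 i2E] := @linear_of R B (A' * B)%type (fun b => (0, b)).
  move=> a x y; congr pair; by rewrite /= scaler0 addr0.
have [B' [p [pS pE]]] := cokernel_exists d.
have pD x b : p (i1 x) + p (i2 b) = p (x, b).
  rewrite -linearD i1E i2E; congr (p _).
  by congr pair; rewrite /= ?addr0 ?add0r.
exists B', (p \o i1), (p \o i2); split=> /=.
- by move=> y; have [[x b] <-] := pS y; exists x, b; rewrite pD.
- move=> x b; rewrite pD pE; split=> -[a].
    by rewrite dE => -[<- <-]; exists a.
  by move=> [-> ->]; exists a; rewrite dE.
- move=> D k l kl.
  have [|n nE] := @linear_of R (A' * B)%type D (fun y => k y.1 + l y.2).
    by move=> a x y; rewrite !linearP scalerDr addrACA.
  have [|m mE] := @factor_surj _ _ _ p n pS.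
    by move=> y /pE[a <-]; rewrite nE dE /= linearN kl subrr.
  exists m; split=> [x|b]; rewrite mE nE ?i1E ?i2E /= linear0 ?addr0 ?add0r //.
Qed.

Lemma pullback_exists B C C' (g : {linear B -> C}) (h : {linear C' -> C}) :
  exists (B' : lmodType R) (g' : {linear B' -> C'}) (h' : {linear B' -> B}),
  [/\ forall y, g (h' y) = h (g' y),
      forall y, g' y = 0 -> h' y = 0 -> y = 0
    & forall D (k : {linear D -> C'}) (l : {linear D -> B}),
      (forall d, g (l d) = h (k d)) ->
      exists m : {linear D -> B'},
        (forall d, g' (m d) = k d) /\ (forall d, h' (m d) = l d)].
Proof.
have [|d dE] := @linear_of R (C' * B)%type C (fun y => h y.1 - g y.2).
  by move=> a x y; rewrite !linearP scalerDr addrACA.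
have [|q1 q1E] := @linear_of R (C' * B)%type C' (fun y => y.1) => //.
have [|q2 q2E] := @linear_of R (C' * B)%type B (fun y => y.2) => //.
have [B' [i [iI iE]]] := kernel_exists d.
exists B', (q1 \o i), (q2 \o i); split=> /=.
- move=> y; have := short_exact0 y iE; rewrite dE q1E q2E.
  by move/eqP; rewrite subr_eq0 => /eqP.
- move=> y; rewrite q1E q2E => y1 y2; apply: iI; rewrite linear0.
  by rewrite [i y]surjective_pairing y1 y2.
- move=> D k l kl.
  have [|n nE] := @linear_of R D (C' * B)%type (fun y => (k y, l y)).
    by move=> a x y; rewrite !linearP.
  have [|m mE] := @factor_inj _ _ _ i n iI.
    by move=> c; apply/iE; rewrite dE nE /= kl subrr.
  by exists m; split=> c; rewrite mE nE ?q1E ?q2E.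
Qed.

Lemma short_exact_pushout A B C A' (f : {linear A -> B}) (g : {linear B -> C})
    (h : {linear A -> A'}) : short_exact f g ->
  exists (B' : lmodType R) (f' : {linear A' -> B'}) (g' : {linear B' -> C})
         (h' : {linear B -> B'}),
  [/\ short_exact f' g', forall a, h' (f a) = f' (h a),
      forall b, g' (h' b) = g b,
      forall D (k : {linear A' -> D}), short_exact h k ->
        exists k' : {linear B' -> D}, short_exact h' k'
    & forall D (k : {linear D -> A}), short_exact k h ->
        short_exact (f \o k) h'].
Proof.
move=> [fI e gS]; have [B' [f' [h' [B'S B'0 B'U]]]] := pushout_exists f h.
have hf a : h' (f a) = f' (h a).
  have : f' (h a) + h' (- f a) = 0 by apply/B'0; exists a.
  by rewrite linearN => /subr0_eq.
have [g' [gf' gh']] : exists g' : {linear B' -> C},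
    (forall x, g' (f' x) = 0) /\ (forall b, g' (h' b) = g b).
  have [m [m1 m2]] := B'U C \0 g (fun a => esym (short_exact0 a e)).
  by exists m.
exists B', f', g', h'; split=> //.
- split.
  + apply: raddf_inj => x fx.
    have /B'0[a [-> /eqP]] : f' x + h' 0 = 0 by rewrite fx linear0 addr0.
    by rewrite eq_sym oppr_eq0 raddf_eq0 // => /eqP->; rewrite linear0.
  + move=> y; split=> [gy|[x <-]]; last by rewrite gf'.
    have [x [b yE]] := B'S y; move: gy.
    rewrite yE linearD gf' gh' add0r => /e[a <-].
    by exists (x + h a); rewrite linearD hf.
  + by move=> c; have [b <-] := gS c; exists (h' b).
- move=> D k [hI hk kS].
  have [k' [kf kh]] : exists k' : {linear B' -> D},
      (forall x, k' (f' x) = k x) /\ (forall b, k' (h' b) = 0).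
    by have [m [m1 m2]] := B'U D k \0 (fun a => short_exact0 a hk); exists m.
  exists k'; split.
  + apply: raddf_inj => b hb.
    have /B'0[a [/esym/eqP]] : f' 0 + h' b = 0 by rewrite hb linear0 addr0.
    by rewrite raddf_eq0 // => /eqP-> ->; rewrite linear0 oppr0.
  + move=> y; split=> [ky|[b <-]]; last by rewrite kh.
    have [x [b yE]] := B'S y; move: ky.
    rewrite yE linearD kf kh addr0 => /hk[a <-].
    by exists (f a + b); rewrite linearD hf.
  + by move=> d; have [x <-] := kS d; exists (f' x).
- move=> D k [kI kh hS]; split=> /=.
  + by move=> x y /fI/kI.
  + move=> b; split=> [hb|[d <-]]; last first.
      by rewrite /= hf (short_exact0 _ kh) linear0.
    have /B'0[a [/esym/kh[d <-] ->]] : f' 0 + h' b = 0.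
      by rewrite hb linear0 addr0.
    by exists (- d); rewrite /= !linearN.
  + move=> y; have [x [b ->]] := B'S y; have [a <-] := hS x.
    by exists (f a + b); rewrite linearD hf.
Qed.

Lemma short_exact_pullback A B C C' (f : {linear A -> B}) (g : {linear B -> C})
    (h : {linear C' -> C}) : short_exact f g ->
  exists (B' : lmodType R) (f' : {linear A -> B'}) (g' : {linear B' -> C'})
         (h' : {linear B' -> B}),
  [/\ short_exact f' g', forall a, h' (f' a) = f a,
      forall y, g (h' y) = h (g' y),
      forall D (k : {linear D -> C'}), short_exact k h ->
        exists k' : {linear D -> B'}, short_exact k' h'
    & forall D (k : {linear C -> D}), short_exact h k ->
        short_exact h' (k \o g)].
Proof.
move=> [fI e gS]; have [B' [g' [h' [gh B'0 B'U]]]] := pullback_exists g h.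
have [f' [gf' hf']] : exists f' : {linear A -> B'},
    (forall a, g' (f' a) = 0) /\ (forall a, h' (f' a) = f a).
  have [|m [m1 m2]] := B'U A \0 f.
    by move=> a /=; rewrite linear0 (short_exact0 _ e).
  by exists m.
have B'1 y y' : g' y = g' y' -> h' y = h' y' -> y = y'.
  move=> gy hy; apply: subr0_eq; apply: B'0; by rewrite linearB ?gy ?hy subrr.
(* A compatible pair of elements is a compatible pair of maps from the free module [R^o], so the
   universal property supplies the point. *)
have B'E b c : g b = h c -> exists y, h' y = b /\ g' y = c.
  move=> bc.
  have [|k kE] := @linear_of R R^o B (fun a => a *: b).
    by move=> a x y; rewrite scalerDl scalerA.
  have [|l lE] := @linear_of R R^o C' (fun a => a *: c).
    by move=> a x y; rewrite scalerDl scalerA.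
  have [|m [m1 m2]] := B'U R^o l k.
    by move=> a; rewrite kE lE !linearZ bc.
  by exists (m 1); rewrite m1 m2 kE lE !scale1r.
exists B', f', g', h'; split=> //.
- split.
  + by move=> x y /(congr1 h'); rewrite !hf' => /fI.
  + move=> y; split=> [gy|[x <-]]; last by rewrite gf'.
    have /e[a aE] : g (h' y) = 0 by rewrite gh gy linear0.
    by exists a; apply: B'1; rewrite ?gf' ?hf'.
  + move=> c; have [b bE] := gS (h c).
    by have [y [_ yE]] := B'E _ _ bE; exists y.
- move=> D k [kI hk hS].
  have [k' [gk' hk']] : exists k' : {linear D -> B'},
      (forall d, g' (k' d) = k d) /\ (forall d, h' (k' d) = 0).
    have [|m [m1 m2]] := B'U D k \0.
      by move=> d /=; rewrite linear0 (short_exact0 _ hk).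
    by exists m.
  exists k'; split.
  + by move=> x y /(congr1 g'); rewrite !gk' => /kI.
  + move=> y; split=> [hy|[x <-]]; last by rewrite hk'.
    have /hk[d dE] : h (g' y) = 0 by rewrite -gh hy linear0.
    by exists d; apply: B'1; rewrite ?gk' ?hk'.
  + move=> b; have [c cE] := hS (g b).
    by have [y [yE _]] := B'E _ _ (esym cE); exists y.
- move=> D k [hI hk kS]; split=> /=.
  + apply: raddf_inj => y hy; apply: B'0 => //; apply: hI.
    by rewrite -gh hy !linear0.
  + move=> b; split=> [/hk[c cE]|[y <-]].
      by have [y [yE _]] := B'E _ _ (esym cE); exists y.
    by rewrite /= gh (short_exact0 _ hk).
  + by move=> d; have [c <-] := kS d; have [b <-] := gS c; exists b.
Qed.
End ModuleDiagrams.

Definition module_category (R : nzRingType) : exact_category.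
Proof.
refine (@ExactCategory (lmodType R) (fun A B => {linear A -> B})
  (fun A => idfun) (fun A B C g f => g \o f) _ _ _ (@short_exact R)
  _ _ _ _ _ _ _).
- by move=> *; apply: linear_ext.
- by move=> *; apply: linear_ext.
- by move=> *; apply: linear_ext.
- move=> A B C A' B' C' f g f' g' u w fg fg' e.
  have [|v vE] := @short_exact_fill_left R _ _ _ _ _ _ _ _ _ _ u w fg fg'.
    by move=> b; apply: (congr1 (fun h : {linear _ -> _} => h b) e).
  by exists v; apply: linear_ext.
- move=> A B C A' B' C' f g f' g' v u fg fg' e.
  have [|w wE] := @short_exact_fill_right R _ _ _ _ _ _ _ _ _ _ v u fg fg'.
    by move=> b; apply: (congr1 (fun h : {linear _ -> _} => h b) e).
  by exists w; apply: linear_ext.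
- move=> A B C A' B' C' f g f' g' v u w fg fg' e1 e2 [s sE].
  have [|||t tE] := @short_exact_homotopy_lift
      R _ _ _ _ _ _ _ _ _ _ v u w fg fg' _ _ s.
  + by move=> b; apply: (congr1 (fun h : {linear _ -> _} => h b) e1).
  + by move=> b; apply: (congr1 (fun h : {linear _ -> _} => h b) e2).
  + by move=> b; apply: (congr1 (fun h : {linear _ -> _} => h b) sE).
  by exists t; apply: linear_ext.
- move=> A B C A' B' C' f g f' g' v u w fg fg' e1 e2 [t tE].
  have [|||s sE] := @short_exact_homotopy_extend
      R _ _ _ _ _ _ _ _ _ _ v u w fg fg' _ _ t.
  + by move=> b; apply: (congr1 (fun h : {linear _ -> _} => h b) e1).
  + by move=> b; apply: (congr1 (fun h : {linear _ -> _} => h b) e2).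
  + by move=> b; apply: (congr1 (fun h : {linear _ -> _} => h b) tE).
  by exists s; apply: linear_ext.
- move=> A B C f g r fg e.
  have [|s sr] := short_exact_flip fg (r := r).
    by move=> b; apply: (congr1 (fun h : {linear _ -> _} => h b) e).
  by exists s, r.
- move=> A B C A' f g h fg.
  have [B' [f' [g' [h' [h1 h2 h3 h4 h5]]]]] := short_exact_pushout h fg.
  by exists B', f', g', h'; split=> //; apply: linear_ext.
- move=> A B C C' f g h fg.
  have [B' [f' [g' [h' [h1 h2 h3 h4 h5]]]]] := short_exact_pullback h fg.
  by exists B', f', g', h'; split=> //; apply: linear_ext.
Defined.

(** * Projectives, injectives and Ext in the category of modules *)

Section Bridge.
Variable R : nzRingType.
Implicit Types A B C D I K M N P Q X Y : lmodType R.
Let E := module_category R.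
Let O := opposite E.

Lemma linear_app A B (f g : {linear A -> B}) x : f = g -> f x = g x.
Proof. by move->. Qed.

Lemma projectiveE P : projective P <-> @proj E P.
Proof.
split=> [pP A B C f g [_ _ gS] h|pP A B g f gS].
  by have [k kE] := pP _ _ _ h gS; exists k; apply: linear_ext.
have [K [i ig]] := short_exact_ker gS.
have [h hE] := pP _ _ _ _ _ ig f; exists h => x; exact: (linear_app x hE).
Qed.

Lemma injectiveE I : injective_module I <-> @proj O I.
Proof.
split=> [iI A B C f g [gI _ _] h|iI A B i f inji].
  by have [k kE] := iI _ _ _ h gI; exists k; apply: linear_ext.
have [C [p ip]] := short_exact_coker inji.
have [h hE] := iI _ _ _ _ _ ip f; exists h => x; exact: (linear_app x hE).
Qed.

Lemma orth_extend X M A B (f : {linear A -> B}) (g : {linear B -> X}) :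
  @Orth E X M -> short_exact f g ->
  forall h : {linear A -> M},
    exists k : {linear B -> M}, forall a, k (f a) = h a.
Proof.
move=> o fg h; have [k kE] := o _ _ _ _ fg h.
by exists k => a; apply: (linear_app a kE).
Qed.

Lemma orth_linear_lift X M B C (f : {linear M -> B}) (g : {linear B -> C}) :
  @Orth E X M -> short_exact f g ->
  forall h : {linear X -> C},
    exists k : {linear X -> B}, forall a, g (k a) = h a.
Proof.
move=> o fg h; have [k kE] := @orth_lift E _ _ _ _ _ _ o fg h.
by exists k => a; apply: (linear_app a kE).
Qed.

(** Cuts a long exact sequence into short ones: [K] is both the kernel of [g] and the image of
    [f]. *)
Lemma exact_corestrict A B C (f : {linear A -> B}) (g : {linear B -> C}) :
  exact_at f g ->
  exists (K : lmodType R) (i : {linear K -> B}) (e : {linear A -> K}),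
  [/\ injective i, exact_at i g, surjective_map e & forall a, i (e a) = f a].
Proof.
move=> fg; have [K [i [iI iE]]] := kernel_exists g.
have [|e eE] := @factor_inj _ _ _ _ i f iI.
  by move=> a; apply/iE; apply: short_exact0.
exists K, i, e; split=> // k.
have /fg[a aE] : g (i k) = 0 by apply/iE; exists k.
by exists a; apply: iI; rewrite eE.
Qed.

Section HomTo.
Variables (P2 P1 P0 X M : lmodType R).
Variables (d1 : {linear P2 -> P1}) (d0 : {linear P1 -> P0}).
Variable a : {linear P0 -> X}.
Hypotheses (aS : surjective_map a) (d0a : exact_at d0 a) (d10 : exact_at d1 d0).

(** A map on the image [K] of [d0] pulls back to a cocycle on [P1]; a cochain bounding this cocycle
    extends the map to [P0]. *)
Lemma orth_of_hom_to_exact :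
  projective P0 -> hom_to_exact_at M d1 d0 -> @Orth E X M.
Proof.
move=> /projectiveE pP0 hom.
have [K [i [e [iI ia eS ie]]]] := exact_corestrict d0a.
have ses_ia : short_exact i a by [].
apply: (@orth_test E _ _ _ _ _ _ ses_ia (orth_proj pP0)) => h.
have /hom[k kE] : forall x, (h \o e) (d1 x) = 0.
  move=> x /=; have -> : e (d1 x) = 0.
    by apply: iI; rewrite ie (short_exact0 _ d10) linear0.
  by rewrite linear0.
exists k; apply: linear_ext => x; have [y <-] := eS x.
by rewrite /= ie kE.
Qed.

(** A cocycle on [P1] descends to [K], and orthogonality extends it from [K] to [P0]. *)
Lemma hom_to_exact_of_orth : @Orth E X M -> hom_to_exact_at M d1 d0.
Proof.
move=> o h; split=> [hd|[k kE] x]; last first.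
  by rewrite -kE (short_exact0 _ d10) linear0.
have [K [i [e [iI ia eS ie]]]] := exact_corestrict d0a.
have [|h' h'E] := @factor_surj _ _ _ _ e h eS.
  move=> b eb; have /d10[x <-] : d0 b = 0 by rewrite -ie eb linear0.
  exact: hd.
have ses_ia : short_exact i a by [].
have [k kE] := orth_extend o ses_ia h'.
by exists k => b; rewrite -ie kE h'E.
Qed.
End HomTo.

Section HomFrom.
Variables (X I0 I1 I2 M : lmodType R).
Variables (d0 : {linear I0 -> I1}) (d1 : {linear I1 -> I2}).
Variable a : {linear X -> I0}.
Hypotheses (aI : injective a) (ad0 : exact_at a d0) (d01 : exact_at d0 d1).

Lemma coexact_corestrict :
  exists (K : lmodType R) (i : {linear K -> I1}) (e : {linear I0 -> K}),
  [/\ injective i, exact_at i d1, forall x, i (e x) = d0 x & short_exact a e].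
Proof.
have [K [i [e [iI id1 eS ie]]]] := exact_corestrict d01.
exists K, i, e; split=> //; split=> // x.
rewrite -ad0 -ie; split=> [->|]; first by rewrite linear0.
by move=> h; apply: iI; rewrite h linear0.
Qed.

Lemma orth_of_hom_from_exact :
  injective_module I0 -> hom_from_exact_at M d0 d1 -> @Orth E M X.
Proof.
move=> /injectiveE iI0 hom.
have [K [i [e [iI id1 ie ae]]]] := coexact_corestrict.
apply: (@orth_test_op E _ _ _ _ _ _ ae); first exact: (@orth_inj E).
move=> h.
have /hom[k kE] : forall x, d1 ((i \o h) x) = 0.
  by move=> x /=; apply: short_exact0.
exists k; apply: linear_ext => x; apply: iI.
by rewrite /= ie kE.
Qed.

Lemma hom_from_exact_of_orth : @Orth E M X -> hom_from_exact_at M d0 d1.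
Proof.
move=> o h; split=> [hd|[k kE] x]; last by rewrite -kE (short_exact0 _ d01).
have [K [i [e [iI id1 ie ae]]]] := coexact_corestrict.
have [|h' h'E] := @factor_inj _ _ _ _ i h iI; first by move=> c; apply/id1.
have [k kE] := orth_linear_lift o ae h'.
by exists k => b; rewrite -ie kE h'E.
Qed.
End HomFrom.

(** With [ker_in], this remembers that the cycles of a spliced sequence lie in [C], where
    orthogonality is known. *)
Definition coker_in (C : module_class R) A B (f : {linear A -> B}) :=
  exists X (p : {linear B -> X}), [/\ surjective_map p, exact_at f p & C X].

Definition ker_in (C : module_class R) A B (f : {linear A -> B}) :=
  exists X (i : {linear X -> A}), [/\ injective i, exact_at i f & C X].

(** * Splicing short exact sequences into resolutions *)

Section Chains.
Variables T C : module_class R.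

Lemma dependent_choice (S : lmodType R -> lmodType R -> Prop) M : C M ->
  (forall X, C X -> exists Y, C Y /\ S X Y) ->
  exists s : nat -> lmodType R,
    [/\ s 0%N = M, forall n, C (s n) & forall n, S (s n) (s n.+1)].
Proof.
move=> CM CS.
have /choice[f fE] (X : {X | C X}) : exists Y : {Y | C Y}, S (sval X) (sval Y).
  by case: X => X CX; have [Y [CY XY]] := CS X CX; exists (exist _ Y CY).
exists (fun n => sval (iter n f (exist _ M CM))); split=> // n.
exact: (svalP (iter n f _)).
Qed.

Section Right.
Hypothesis right : forall X, C X ->
  exists P Y (f : {linear X -> P}) (g : {linear P -> Y}),
    [/\ short_exact f g, T P & C Y].

Lemma coresolution_exists M : C M -> exists P : coresolution M,
  [/\ forall i, T (P i), coker_in C (cores_aug P),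
      forall i, coker_in C (cores_d P i) & forall i, ker_in C (cores_d P i)].
Proof.
pose S (X Y : lmodType R) :=
  exists P (f : {linear X -> P}) (g : {linear P -> Y}),
  short_exact f g /\ T P.
move=> CM; have [|s [s0 Cs Ss]] := @dependent_choice S M CM.
  move=> X /right[P [Y [f [g [fg TP CY]]]]].
  by exists Y; split=> //; exists P, f, g.
(* Substituting [s 0] for [M] lets [f 0] serve as augmentation without transport. The existentials
   are opened in turn because the types of the maps depend on the chosen objects. *)
subst M; pose P n := projT1 (cid (Ss n)).
have HP n : exists (f : {linear s n -> P n}) (g : {linear P n -> s n.+1}),
  short_exact f g /\ T (P n) := projT2 (cid (Ss n)).
pose f n := projT1 (cid (HP n)).
have Hf n : exists (g : {linear P n -> s n.+1}), short_exact (f n) g /\ T (P n)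
  := projT2 (cid (HP n)).
pose g n := projT1 (cid (Hf n)).
have fg n : short_exact (f n) (g n) by rewrite /g; case: cid => ? [].
have TP n : T (P n) by have [? []] := Hf n.
have [fI fgE gS] : [/\ forall n, injective (f n),
    forall n, exact_at (f n) (g n) & forall n, surjective_map (g n)].
  by split=> n; case: (fg n).
pose d n : {linear P n -> P n.+1} := f n.+1 \o g n.
have fd n : exact_at (f n) (d n).
  move=> b; rewrite -fgE /=; split=> [gb|->]; last by rewrite linear0.
  by apply: (fI n.+1); rewrite gb linear0.
have dg n : exact_at (d n) (g n.+1).
  move=> b; rewrite fgE; split=> -[x <-]; last by exists (g n x).
  by have [y <-] := gS n x; exists y.
have dd n : exact_at (d n) (d n.+1).
  move=> b; rewrite -dg /=; split=> [gb|->]; last by rewrite linear0.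
  by apply: (fI n.+2); rewrite gb linear0.
exists (Coresolution (fI 0%N) (fd 0%N) dd); split=> //=.
- by exists (s 1%N), (g 0%N).
- by move=> i; exists (s i.+2), (g i.+1).
- by move=> i; exists (s i), (f i).
Qed.
End Right.

Section Left.
Hypothesis left : forall X, C X ->
  exists P Y (f : {linear Y -> P}) (g : {linear P -> X}),
    [/\ short_exact f g, T P & C Y].

Lemma resolution_exists M : C M -> exists P : resolution M,
  [/\ forall i, T (P i), ker_in C (res_aug P),
      forall i, coker_in C (res_d P i) & forall i, ker_in C (res_d P i)].
Proof.
pose S (X Y : lmodType R) :=
  exists P (f : {linear Y -> P}) (g : {linear P -> X}),
  short_exact f g /\ T P.
move=> CM; have [|s [s0 Cs Ss]] := @dependent_choice S M CM.
  move=> X /left[P [Y [f [g [fg TP CY]]]]].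
  by exists Y; split=> //; exists P, f, g.
subst M; pose P n := projT1 (cid (Ss n)).
have HP n : exists (f : {linear s n.+1 -> P n}) (g : {linear P n -> s n}),
  short_exact f g /\ T (P n) := projT2 (cid (Ss n)).
pose f n := projT1 (cid (HP n)).
have Hf n : exists (g : {linear P n -> s n}), short_exact (f n) g /\ T (P n)
  := projT2 (cid (HP n)).
pose g n := projT1 (cid (Hf n)).
have fg n : short_exact (f n) (g n) by rewrite /g; case: cid => ? [].
have TP n : T (P n) by have [? []] := Hf n.
have [fI fgE gS] : [/\ forall n, injective (f n),
    forall n, exact_at (f n) (g n) & forall n, surjective_map (g n)].
  by split=> n; case: (fg n).
pose d n : {linear P n.+1 -> P n} := f n \o g n.+1.
have fd n : exact_at (f n.+1) (d n).
  move=> b; rewrite -fgE /=; split=> [gb|->]; last by rewrite linear0.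
  by apply: (fI n); rewrite gb linear0.
have dg n : exact_at (d n) (g n).
  move=> b; rewrite fgE; split=> -[x <-]; last by exists (g n.+1 x).
  by have [y <-] := gS n.+1 x; exists y.
have dd n : exact_at (d n.+1) (d n).
  move=> b; rewrite -dg /=; split=> [gb|->]; last by rewrite linear0.
  by apply: (fI n); rewrite gb linear0.
exists (Resolution (gS 0%N) (dg 0%N) dd); split=> //=.
- by exists (s 1%N), (f 0%N).
- by move=> i; exists (s i), (g i).
- by move=> i; exists (s i.+2), (f i.+1).
Qed.
End Left.
End Chains.
End Bridge.

(** * Totally acyclic complexes and dimensions *)

Section Sequences.
Variable R : nzRingType.
Implicit Types A B C D I K M N P Q X Y : lmodType R.

Definition spot_predicate :=
  forall A B C, {linear A -> B} -> {linear B -> C} -> Prop.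

Lemma at_each_spot_impl (S S' : spot_predicate) (X : sequence R) :
  (forall A B C (f : {linear A -> B}) (g : {linear B -> C}),
    S _ _ _ f g -> S' _ _ _ f g) ->
  at_each_spot S X -> at_each_spot S' X.
Proof. by move=> SS' [h1 h2 h3 h4]; split=> *; apply: SS'. Qed.

(** The middle map becomes [X^0 -> X^1], so the next cycle is now the distinguished image;
    [shift_left] moves to the previous one. *)
Definition shift_right (X : sequence R) : sequence R :=
  @Sequence R (fun n => if n is n'.+1 then cpx_lo X n' else cpx_up X 0)
    (fun n => cpx_up X n.+1)
    (fun n => if n is n'.+1 then cpx_dlo X n' else cpx_mid X)
    (cpx_dup X 0) (fun n => cpx_dup X n.+1).

Definition shift_left (X : sequence R) : sequence R :=
  @Sequence R (fun n => cpx_lo X n.+1)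
    (fun n => if n is n'.+1 then cpx_up X n' else cpx_lo X 0)
    (fun n => cpx_dlo X n.+1) (cpx_dlo X 0)
    (fun n => if n is n'.+1 then cpx_dup X n' else cpx_mid X).

Lemma shift_right_spot (S : spot_predicate) (X : sequence R) :
  at_each_spot S X -> at_each_spot S (shift_right X).
Proof. by move=> [h1 h2 h3 h4]; split=> //=; case=> //=. Qed.

Lemma shift_left_spot (S : spot_predicate) (X : sequence R) :
  at_each_spot S X -> at_each_spot S (shift_left X).
Proof. by move=> [h1 h2 h3 h4]; split=> //=; case=> //=. Qed.

Lemma shift_right_terms T (X : sequence R) :
  all_terms_in T X -> all_terms_in T (shift_right X).
Proof.
move=> h n; split; last by case: (h n.+1).
by case: n => [|n]; [case: (h 0%N) | case: (h n)].
Qed.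

Lemma shift_left_terms T (X : sequence R) :
  all_terms_in T X -> all_terms_in T (shift_left X).
Proof.
move=> h n; split; first by case: (h n.+1).
by case: n => [|n]; [case: (h 0%N) | case: (h n)].
Qed.

(* [GP] and [GI] are both of this form, with [H] the Hom-exactness condition. *)
Definition cycle_of (T : module_class R) (H : sequence R -> Prop) M :=
  exists X : sequence R,
    [/\ all_terms_in T X, exact_sequence X, iso_image M (cpx_mid X) & H X].

Lemma cycle_of_iso T H M N (u : {linear M -> N}) :
  injective u -> surjective_map u -> cycle_of T H N -> cycle_of T H M.
Proof.
move=> uI uS [X [XT Xe [j [jI jE]] XH]]; exists X; split=> //.
exists (j \o u); split=> [x y /jI/uI //|b]; rewrite -jE.
split=> -[x <-]; first by exists (u x).
by have [y <-] := uS x; exists y.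
Qed.

Section Cycles.
Variables (T : module_class R) (H : sequence R -> Prop) (M : lmodType R).
Hypothesis H_right : forall X : sequence R, H X -> H (shift_right X).
Hypothesis H_left : forall X : sequence R, H X -> H (shift_left X).

Lemma cycle_of_right : cycle_of T H M ->
  exists P Y (f : {linear M -> P}) (g : {linear P -> Y}),
    [/\ short_exact f g, T P & cycle_of T H Y].
Proof.
move=> [X [XT Xe [j [jI jE]] XH]].
have [_ _ mid_up up_up] := Xe.
have [K [i [e [iI iup eS ie]]]] := exact_corestrict (up_up 0%N).
exists (cpx_up X 0), K, j, e; split.
- split=> // b; rewrite jE -mid_up -ie; split=> [->|]; first by rewrite linear0.
  by move=> h; apply: iI; rewrite h linear0.
- by case: (XT 0%N).
- exists (shift_right X); split; first exact: shift_right_terms.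
  + exact: shift_right_spot.
  + by exists i; split=> // b; rewrite -iup up_up.
  + exact: H_right.
Qed.

Lemma cycle_of_lower : cycle_of T H M ->
  exists (X : sequence R) (e : {linear cpx_lo X 0 -> M}),
  [/\ all_terms_in T X, exact_sequence X, H X, surjective_map e
    & exact_at (cpx_dlo X 0) e].
Proof.
move=> [X [XT Xe [j [jI jE]] XH]]; exists X.
have [_ lo_mid _ _] := Xe.
have [|e eE] := @factor_inj _ _ _ _ j (cpx_mid X) jI.
  by move=> x; apply/jE; exists x.
exists e; split=> //.
- move=> m; have /jE[x xE] : exists m', j m' = j m by exists m.
  by exists x; apply: jI; rewrite eE.
- move=> b; rewrite -lo_mid -eE.
  by split=> [->|h]; [rewrite linear0 | apply: jI; rewrite h linear0].
Qed.

Lemma cycle_of_left : cycle_of T H M ->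
  exists P Y (f : {linear Y -> P}) (g : {linear P -> M}),
    [/\ short_exact f g, T P & cycle_of T H Y].
Proof.
move=> /cycle_of_lower[X [e [XT Xe XH eS de]]].
have [K [i [iI ie]]] := kernel_exists e.
exists (cpx_lo X 0), K, i, e; split=> //; first by case: (XT 0%N).
exists (shift_left X); split; first exact: shift_left_terms.
- exact: shift_left_spot.
- by exists i; split=> // b; rewrite -ie -de.
- exact: H_left.
Qed.

Lemma cycle_of_upper : cycle_of T H M ->
  exists (X : sequence R) (j : {linear M -> cpx_up X 0}),
  [/\ all_terms_in T X, exact_sequence X, H X, injective j
    & exact_at j (cpx_dup X 0)].
Proof.
move=> [X [XT Xe [j [jI jE]] XH]]; exists X, j; split=> // b.
by rewrite jE; case: Xe => _ _ + _; apply.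
Qed.
End Cycles.

Section Splice.
Variables T C : module_class R.
Hypothesis right : forall X, C X ->
  exists P Y (f : {linear X -> P}) (g : {linear P -> Y}),
    [/\ short_exact f g, T P & C Y].
Hypothesis left : forall X, C X ->
  exists P Y (f : {linear Y -> P}) (g : {linear P -> X}),
    [/\ short_exact f g, T P & C Y].

Lemma splice_exists M : C M -> exists X : sequence R,
  [/\ all_terms_in T X, iso_image M (cpx_mid X)
    & at_each_spot (fun A B D (f : {linear A -> B}) (g : {linear B -> D}) =>
        [/\ exact_at f g, ker_in C f & coker_in C g]) X].
Proof.
move=> CM; have [P [PT Pk Pc Pk']] := resolution_exists left CM.
have [Q [QT Qc Qc' Qk]] := coresolution_exists right CM.
(* The two halves are joined through [M], which thereby is the image of the middle map. *)
pose m := (cores_aug Q \o res_aug P : {linear P 0%N -> Q 0%N}).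
have mimg b : (exists x, cores_aug Q x = b) <-> (exists y, m y = b).
  split=> -[x <-]; last by exists (res_aug P x).
  by have [y <-] := res_aug_surj P x; exists y.
have mker b : m b = 0 <-> res_aug P b = 0.
  rewrite /m /=; split=> [h|->]; last by rewrite linear0.
  by apply: (@cores_aug_inj _ _ Q); rewrite h linear0.
exists (@Sequence R P Q (res_d P) m (cores_d Q)); split=> //=.
- by move=> i; split; [apply: PT | apply: QT].
- by exists (cores_aug Q); split; [exact: (@cores_aug_inj _ _ Q) | exact: mimg].
- split=> [i|||i] /=; split=> //.
  + exact: (@res_exactS _ _ P i).
  + by move=> b; rewrite mker; exact: (@res_exact0 _ _ P b).
  + have [X [p [pS pE CX]]] := Qc; exists X, p; split=> // b.
    by rewrite pE.
  + by move=> b; rewrite -mimg; exact: (@cores_exact0 _ _ Q b).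
  + have [X [p [pI pE CX]]] := Pk; exists X, p; split=> // b.
    by rewrite mker.
  + exact: (@cores_exactS _ _ Q i).
Qed.
End Splice.

(** * Comparison of [GP], [GI] and [Ext1_eq0] with their categorical forms *)

Let E := module_category R.
Let O := opposite E.

Definition hom_to_projectives (X : sequence R) :=
  forall Q, projective Q -> hom_to_exact Q X.
Definition hom_from_injectives (X : sequence R) :=
  forall I, injective_module I -> hom_from_exact I X.

(** Shifting a complete resolution shows that [GP] is itself a class of cycles; conversely, the
    cycles in [C] are spliced into one. *)
Lemma GP_GProj M : GP M <-> @GProj E M.
Proof.
split=> [gM|[C [CM CP]]].
  have Hr (X : sequence R) :
      hom_to_projectives X -> hom_to_projectives (shift_right X).
    by move=> h Q /h; apply: (@shift_right_spot (@hom_to_exact_at R Q)).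
  have Hl (X : sequence R) :
      hom_to_projectives X -> hom_to_projectives (shift_left X).
    by move=> h Q /h; apply: (@shift_left_spot (@hom_to_exact_at R Q)).
  exists (@GP R); split=> // X gX; split.
  - move=> Q /projectiveE pQ.
    have [S [e [ST Se SH eS de]]] := cycle_of_lower gX.
    have [h1 _ _ _] := Se; have [h2 _ _ _] := SH _ pQ.
    apply: (orth_of_hom_to_exact eS de (h1 0%N)) => //.
    by case: (ST 0%N).
  - have [P [Y [f [g [fg /projectiveE pP gY]]]]] := cycle_of_right Hr gX.
    by exists P, Y, f, g.
  - have [P [Y [f [g [fg /projectiveE pP gY]]]]] := cycle_of_left Hl gX.
    by exists P, Y, f, g.
have [||X [XT Xi Xs]] := @splice_exists (@projective R) C _ _ M CM.
- move=> X /CP[_ [P [Y [f [g [fg /projectiveE pP CY]]]]] _].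
  by exists P, Y, f, g.
- move=> X /CP[_ _ [P [Y [f [g [fg /projectiveE pP CY]]]]]].
  by exists P, Y, f, g.
exists X; split=> //; first by apply: at_each_spot_impl Xs => A B D f g [].
move=> Q /projectiveE pQ; apply: at_each_spot_impl Xs.
(* Exactness of Hom(-, Q) at [B] is the vanishing of Ext^1(Y, Q) for the cokernel [Y] of [g], which
   lies in [C]. *)
move=> A B D f g [fg _ [Y [p [pS pE /CP[oY _ _]]]]].
by apply: (hom_to_exact_of_orth pS pE fg); apply: oY.
Qed.

Lemma GI_GProj M : GI M <-> @GProj O M.
Proof.
split=> [gM|[C [CM CP]]].
  have Hr (X : sequence R) :
      hom_from_injectives X -> hom_from_injectives (shift_right X).
    by move=> h Q /h; apply: (@shift_right_spot (@hom_from_exact_at R Q)).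
  have Hl (X : sequence R) :
      hom_from_injectives X -> hom_from_injectives (shift_left X).
    by move=> h Q /h; apply: (@shift_left_spot (@hom_from_exact_at R Q)).
  exists (@GI R); split=> // X gX; split.
  - move=> Q /injectiveE iQ; apply: (@orth_op E).
    have [S [e [ST Se SH eI ed]]] := cycle_of_upper gX.
    have [_ _ _ h1] := Se; have [_ _ _ h2] := SH _ iQ.
    apply: (orth_of_hom_from_exact eI ed (h1 0%N)) => //.
    by case: (ST 0%N).
  - have [P [Y [f [g [fg /injectiveE pP gY]]]]] := cycle_of_left Hl gX.
    by exists P, Y, g, f.
  - have [P [Y [f [g [fg /injectiveE pP gY]]]]] := cycle_of_right Hr gX.
    by exists P, Y, g, f.
have [||X [XT Xi Xs]] := @splice_exists (@injective_module R) C _ _ M CM.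
- move=> X /CP[_ _ [P [Y [f [g [fg /injectiveE pP CY]]]]]].
  by exists P, Y, g, f.
- move=> X /CP[_ [P [Y [f [g [fg /injectiveE pP CY]]]]] _].
  by exists P, Y, g, f.
exists X; split=> //; first by apply: at_each_spot_impl Xs => A B D f g [].
move=> Q /injectiveE iQ; apply: at_each_spot_impl Xs.
move=> A B D f g [fg [Y [i [iI iE /CP[oY _ _]]]] _].
by apply: (hom_from_exact_of_orth iI iE fg); apply: (@orth_opK E); apply: oY.
Qed.

(** [Ext1_eq0] quantifies over projective resolutions, so one must exist for it to say anything;
    [enough] provides it. *)
Lemma Ext1_eq0E X M : @enough_proj E -> Ext1_eq0 X M <-> @Orth E X M.
Proof.
move=> enough; split=> [ext|o P _]; last first.
  exact: (hom_to_exact_of_orth (@res_aug_surj _ _ P) (@res_exact0 _ _ P)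
    (@res_exactS _ _ P 0%N) o).
have [|//|P [PT _ _ _]] :=
    @resolution_exists R (@projective R) (fun _ => True) _ X.
  move=> Y _; have [K [P [f [g [fg /projectiveE pP]]]]] := enough Y.
  by exists P, K, f, g.
exact: (orth_of_hom_to_exact (@res_aug_surj _ _ P) (@res_exact0 _ _ P)
    (@res_exactS _ _ P 0%N) (PT 0%N) (ext P PT)).
Qed.

Lemma least_le (P : nat -> Prop) d :
  le_dim (least P) (Some d) -> exists2 n, (n <= d)%N & P n.
Proof.
rewrite /least; case: pselect => // exP /=.
by case: ex_minnP => n /asboolP Pn _ nd; exists n.
Qed.

Lemma zero_module_inj A B C (f : {linear A -> B}) (g : {linear B -> C}) :
  zero_module A -> exact_at f g -> injective g.
Proof.
move=> A0 fg; apply: raddf_inj => b /fg[a <-].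
by rewrite (A0 a) linear0.
Qed.

Lemma zero_module_surj A B C (f : {linear A -> B}) (g : {linear B -> C}) :
  zero_module C -> exact_at f g -> surjective_map f.
Proof. by move=> C0 fg b; apply/fg; apply: C0. Qed.

(** Induction on the length, passing to the first syzygy with the shifted resolution. In length 0
    the augmentation is an isomorphism with inverse [u]. *)
Lemma GP_resolution_dim M n : has_GP_resolution M n -> @gid_le O n M.
Proof.
elim: n M => [|n IH] M [G [Gg G0]].
  left; apply/(@GProj_opK E)/GP_GProj.
  have aI := zero_module_inj (G0 1%N isT) (res_exact0 (r:=G)).
  have [|u uE] := @factor_surj R _ _ _ (res_aug G) idfun (@res_aug_surj _ _ G).
    by move=> a ea; apply: aI; rewrite ea linear0.
  apply: (cycle_of_iso (u := u) _ _ (Gg 0%N isT)).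
    move=> x y; have [a <-] := res_aug_surj G x.
    by have [b <-] := res_aug_surj G y; rewrite !uE => /= ->.
  by move=> a; exists (res_aug G a); rewrite uE.
right; have [K [i [e [iI ia eS ie]]]] := exact_corestrict (res_exact0 (r:=G)).
exists (G 0%N), K, (res_aug G), i; split.
- by split=> //; apply: res_aug_surj.
- by apply/(@GProj_opK E)/GP_GProj; apply: Gg.
- apply: IH.
  have de : exact_at (res_d G 1%N) e.
    move=> b; rewrite -(@res_exactS _ _ G 0%N) -ie.
    by split=> [->|h]; [rewrite linear0 | apply: iI; rewrite h linear0].
  exists (Resolution eS de (fun i => @res_exactS _ _ G i.+1)).
  by split=> j jn /=; [apply: Gg | apply: G0].
Qed.

Lemma GI_coresolution_dim M n : has_GI_coresolution M n -> @gid_le E n M.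
Proof.
elim: n M => [|n IH] M [G [Gg G0]].
  left; apply/(@GI_GProj M).
  apply: (cycle_of_iso (u := cores_aug G) _ _ (Gg 0%N isT)).
    exact: cores_aug_inj.
  exact: (zero_module_surj (G0 1%N isT) (cores_exact0 (c:=G))).
right.
have [K [i [e [iI id1 ie ae]]]] := coexact_corestrict
  (@cores_aug_inj _ _ G) (@cores_exact0 _ _ G) (@cores_exactS _ _ G 0%N).
exists (G 0%N), K, (cores_aug G), e; split=> //.
  by apply/(@GI_GProj (G 0%N)); apply: Gg.
apply: IH.
exists (Coresolution iI id1 (fun i => @cores_exactS _ _ G i.+1)).
by split=> j jn /=; [apply: Gg | apply: G0].
Qed.

(** * The two cotorsion theories over a ring of finite Gorenstein global dimension *)

Section FiniteGlobalDimension.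
Variable d : nat.
Hypothesis hd : is_lGgldim R (Some d).

Lemma gpd_le M : @gid_le O d M.
Proof.
have [n nd /GP_resolution_dim] := least_le (hd.1.1 M).
exact: gid_leW.
Qed.

Lemma gid_le_d M : @gid_le E d M.
Proof.
have [n nd /GI_coresolution_dim] := least_le (hd.2.1 M).
exact: gid_leW.
Qed.

(** [M] is a quotient of the term [G 0] of its Gorenstein projective resolution, and [G 0] is a
    quotient of a projective. *)
Lemma enough_projectives : @enough_proj E.
Proof.
move=> M; have [n _ [G [Gg _]]] := least_le (hd.1.1 M).
have /GP_GProj/GProj_left[P [X [f [g [[/= _ _ gS] pP _]]]]] := Gg 0%N isT.
have [|K [i ih]] := @short_exact_ker R _ _ (res_aug G \o g : {linear P -> M}).
  move=> m; have [x <-] := res_aug_surj G m; have [y <-] := gS x.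
  by exists y.
by exists K, P, i, (res_aug G \o g).
Qed.

Lemma enough_injectives : @enough_proj O.
Proof.
move=> M; have [n _ [G [Gg _]]] := least_le (hd.2.1 M).
have /GI_GProj/GProj_left[P [X [f [g [[/= gI _ _] iP _]]]]] := Gg 0%N isT.
have [|K [i ih]] :=
    @short_exact_coker R _ _ (g \o cores_aug G : {linear M -> P}).
  by move=> x y /gI/(@cores_aug_inj _ _ G).
by exists K, P, i, (g \o cores_aug G).
Qed.

Let enP := enough_projectives.
Let fin : finite_Gorenstein_dimension E d :=
  Build_finite_Gorenstein_dimension enough_projectives enough_injectives
    gid_le_d gpd_le.
Let fin_op := finite_Gorenstein_dimension_op fin.

Lemma rperp_GP M : rperp (@GP R) M <-> perpR (@GProj E) M.
Proof.
split=> h X gX; first by apply/(Ext1_eq0E _ _ enP); apply: h; apply/GP_GProj.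
by apply/(Ext1_eq0E _ _ enP); apply: h; apply/GP_GProj.
Qed.

Lemma lperp_GI M : lperp (@GI R) M <-> perpR (@GProj O) M.
Proof.
split=> h X gX.
  by apply: (@orth_op E); apply/(Ext1_eq0E _ _ enP); apply: h; apply/GI_GProj.
by apply/(Ext1_eq0E _ _ enP); apply: (@orth_opK E); apply: h; apply/GI_GProj.
Qed.

Lemma lperp_rperp_GP M : lperp (rperp (@GP R)) M <-> GP M.
Proof.
split=> [h|gM X]; last exact.
apply/GP_GProj; apply: (perpL_GProj fin) => X YX.
by apply/(Ext1_eq0E _ _ enP); apply: h; apply/rperp_GP.
Qed.

Lemma rperp_lperp_GI M : rperp (lperp (@GI R)) M <-> GI M.
Proof.
split=> [h|gM X]; last exact.
apply/GI_GProj; apply: (perpL_GProj fin_op) => X YX.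
by apply: (@orth_op E); apply/(Ext1_eq0E _ _ enP); apply: h; apply/lperp_GI.
Qed.

Lemma GP_cotorsion :
  complete_hereditary_cotorsion_theory (@GP R) (rperp (@GP R)).
Proof.
split.
- by split=> // M; apply: lperp_rperp_GP.
- move=> M; split.
    have [H [G [f [g [fg YH gG]]]]] := preenv_all fin M.
    have {}gG : GP G by apply/GP_GProj.
    exists H, f; split; last first.
      by exists G, g; split=> //; apply/lperp_rperp_GP.
    split=> [|X YX h]; first exact/rperp_GP.
    (* The preenvelope property follows from Ext^1(G, X) = 0 for the cokernel [G]. *)
    by apply: (orth_extend _ fg); apply/(Ext1_eq0E _ _ enP); apply: YX.
  have [H [G [f [g [fg /rperp_GP YH gG]]]]] := precov_all fin M.
  exists G, g; split; last by exists H, f.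
  split=> [|X gX h]; first exact/GP_GProj.
  by apply: (orth_linear_lift _ fg); apply/(Ext1_eq0E _ _ enP); apply: YH.
- move=> L' L L'' f g fg /GP_GProj gL /GP_GProj gL''; apply/GP_GProj.
  apply: (perpL_GProj fin).
  by apply: (perpL_hereditary (fgd_enough_inj fin) fg); apply: GProj_perpL.
Qed.

Lemma GI_cotorsion :
  complete_hereditary_cotorsion_theory (lperp (@GI R)) (@GI R).
Proof.
split.
- by split=> // M; apply: rperp_lperp_GI.
- move=> M; split.
    have [H [G [f [g [fg /lperp_GI XH gG]]]]] :=
      precov_all fin_op M.
    exists G, g; split; last by exists H, f.
    split=> [|X gX h]; first exact/GI_GProj.
    by apply: (orth_extend _ fg); apply/(Ext1_eq0E _ _ enP); apply: XH.
  have [H [G [f [g [fg XH gG]]]]] := preenv_all fin_op M.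
  have {}gG : GI G by apply/GI_GProj.
  exists H, f; split; last first.
    by exists G, g; split=> //; apply/rperp_lperp_GI.
  split=> [|X YX h]; first exact/lperp_GI.
  by apply: (orth_linear_lift _ fg); apply/(Ext1_eq0E _ _ enP); apply: YX.
- move=> L' L L'' f g fg /lperp_GI XL /lperp_GI XL''; apply/lperp_GI.
  (* The kernel [L'] is a cokernel in [O], so heredity here is closure under cokernels there. *)
  exact: (@perpR_coker O _ _ _ g f fg).
Qed.
End FiniteGlobalDimension.
End Sequences.

Theorem theorem2p4 (R : nzRingType)
    (hR : exists d : nat, is_lGgldim R (Some d)) :
  complete_hereditary_cotorsion_theory (@GP R) (rperp (@GP R)) /\
  complete_hereditary_cotorsion_theory (lperp (@GI R)) (@GI R).
Proof.
by have [d hd] := hR; split; [apply: GP_cotorsion hd | apply: GI_cotorsion hd].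
Qed.
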